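(* There is a discrete protocol in the Robertson–Webb query model with the following guarantee. For every connected undirected graph $G=(V,E)$ on $n=|V|\ge 2$ vertices (agents) and every collection of valuation functions $(f_v)_{v\in V}$, the protocol outputs a complete allocation $\{A_v\}_{v\in V}$ of the cake $[0,1]$ that is locally proportional on $G$, i.e. $f_v(A_v)\ge \frac{1}{d_v}\sum_{u\in N(v)} f_v(A_u)$ for every $v\in V$, and it uses $O(14^n)$ queries.
   Context: The cake is the interval $[0,1]$; a piece is a finite union of disjoint subintervals of $[0,1]$. Each agent $v$ has a valuation function $f_v$ on pieces which is normalized and nonnegative ($f_v([0,1])=1$, $f_v(I)\ge 0$), additive on disjoint pieces, and divisible (for every interval $I$ and $\lambda\in[0,1]$ there is an interval $I'\subseteq I$ with $f_v(I')=\lambda f_v(I)$). An allocation is a family $\{A_v\}_{v\in V}$ of pairwise disjoint pieces, $A_v$ given to agent $v$; it is complete if the union of the $A_v$ is $[0,1]$. $N(v)$ is the set of neighbors of $v$ in $G$ and $d_v=|N(v)|$. Robertson–Webb query model: an evaluation query asks agent $v$ for $f_v([x,y])$; a cut query, given a point $x$, a value $\alpha$ and an agent $v$, returns a point $y$ with $f_v([x,y])=\alpha$. A discrete protocol accesses valuations only through such queries, and its complexity is the total number of queries. *)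

(* Defs.v *)
From HB Require Import structures.
From mathcomp Require Import all_boot all_order all_algebra.
From mathcomp Require Import all_classical all_reals.

Set Implicit Arguments.
Unset Strict Implicit.
Unset Printing Implicit Defensive.

Import Order.TTheory GRing.Theory Num.Theory.
Local Open Scope classical_set_scope.
Local Open Scope ring_scope.

Definition cake (R : realType) : set R := `[0, 1]%classic.
Arguments cake R : clear implicits.

(* End points may be open or closed, and the interval may be empty or a
   single point: disjoint pieces can cover [0, 1] only if half-open intervals
   are allowed. *)
Definition subinterval (R : realType) (I : set R) : Prop :=
  exists i : interval R, I = [set` i] /\ I `<=` cake R.

Definition piece (R : realType) (A : set R) : Prop :=
  exists (m : nat) (I : 'I_m -> set R),
    [/\ forall j, subinterval (I j),
        trivIset setT I
      & A = \bigcup_j I j].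

(* A valuation is a total function on sets, of which only the values on pieces
   are constrained or used. *)
Record valuation (R : realType) (f : set R -> R) : Prop := Valuation {
  valuation_normalized : f (cake R) = 1;
  valuation_ge0 : forall A, piece A -> 0 <= f A;
  valuation_additive : forall A B, piece A -> piece B -> A `&` B = set0 ->
    f (A `|` B) = f A + f B;
  valuation_divisible : forall I, subinterval I ->
    forall lam : R, 0 <= lam <= 1 ->
    exists I', [/\ subinterval I', I' `<=` I & f I' = lam * f I]
}.

(* A protocol is a well-founded decision tree: the valuations are not an
   argument of the tree, so each query and the output depend only on the
   answers received so far. *)
Inductive protocol (R : realType) (V : finType) : Type :=
| Output of V -> set R
| EvalQuery (v : V) (x y : R) of R -> protocol R V
| CutQuery (v : V) (x alpha : R) of R -> protocol R V.

Definition cut_answer (R : realType) (f : set R -> R) (x alpha y : R) : Prop :=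
  x <= y <= 1 /\ f `[x, y]%classic = alpha.

(* Zero-density regions make the answer to a cut query non-unique; every
   correct answer yields a run. *)
Inductive run (R : realType) (V : finType) (f : V -> set R -> R) :
    protocol R V -> nat -> (V -> set R) -> Prop :=
| RunOutput A : run f (Output A) 0 A
| RunEval v x y k q A :
    run f (k (f v `[x, y]%classic)) q A -> run f (EvalQuery v x y k) q.+1 A
| RunCut v x alpha k y q A :
    cut_answer (f v) x alpha y -> run f (k y) q A ->
    run f (CutQuery v x alpha k) q.+1 A.

(* Every query that can be reached is meaningful; in particular a cut query
   must have an answer, so that no run of the protocol gets stuck. *)
Fixpoint legal (R : realType) (V : finType) (f : V -> set R -> R)
    (p : protocol R V) : Prop :=
  match p with
  | Output _ => True
  | EvalQuery v x y k =>
      [/\ 0 <= x, x <= y, y <= 1 & legal f (k (f v `[x, y]%classic))]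
  | CutQuery v x alpha k =>
      [/\ 0 <= x <= 1,
          exists y, cut_answer (f v) x alpha y
        & forall y, cut_answer (f v) x alpha y -> legal f (k y)]
  end.

Definition complete_allocation (R : realType) (V : finType)
    (A : V -> set R) : Prop :=
  [/\ forall v, piece (A v), trivIset setT A & \bigcup_v A v = cake R].

Definition neighbors (V : finType) (e : rel V) (v : V) : {set V} :=
  [set u | e v u]%SET.

Definition locally_proportional (R : realType) (V : finType) (e : rel V)
    (f : V -> set R -> R) (A : V -> set R) : Prop :=
  forall v, f v (A v) >=
    1 / #|neighbors e v|%:R * \sum_(u in neighbors e v) f v (A u).

Record connected_graph (V : finType) (e : rel V) : Prop := ConnectedGraph {
  graph_sym : symmetric e;
  graph_irrefl : irreflexive e;
  graph_connected : forall u v, connect e u v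
}.

(* Main.v *)
(** A partial allocation leaves a residue.  Agent [r] cuts the cake into [n] pieces
    that are equal for her, and the others trim contested pieces until everybody
    holds (part of) a piece without envy and [r] holds a full one.  Either nothing is
    trimmed or, up to a factor [n], [r] prefers her piece to that of some [u] by the
    value of the whole residue: she dominates [u].  Repeating this on the residue makes
    it as small as desired for everyone, and keeps the allocation envy-free.

    If [v] dominates a neighbour, her constraint holds wherever the residue goes.  She
    can then be left out of the next rounds, which gives her neighbours slack; they
    too become indifferent to the (new, much smaller) residue, and by connectivity
    everybody does, so that the residue can be given away.

    If [v] dominates [u] at distance at least two, let [w] be the next vertex on a path
    to [u].  Either [w] and [u] dominate one another on the scale of a much smaller
    residue, and the distance has dropped, or both are nearly indifferent between their
    two pieces.  Swapping these pieces then gives [v] a dominated neighbour [w] and hurts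
    nobody but [w] and [u], by an amount that later rounds compensate. *)

Require Import Defs.
From mathcomp Require Import all_boot all_order all_algebra.
From mathcomp Require Import all_classical all_reals.
From mathcomp Require Import ring lra zify.

Set Implicit Arguments.
Unset Strict Implicit.
Unset Printing Implicit Defensive.
Import Order.TTheory GRing.Theory Num.Theory.

(** * Valuations of intervals *)

Section Valuations.
Local Open Scope classical_set_scope.
Local Open Scope ring_scope.

Variable R : realType.
Implicit Types (A B : set R) (b : bool) (x y p : R) (f : set R -> R).

(** An agent may have zero density anywhere, so a cut point is not determined by its value, and no
    step may rely on unique or optimal trims. The strategies speak instead about the set [K] of
    profiles compatible with the answers: every cut point is at once evaluated by all agents, so all
    profiles of [K] agree on each piece in play, and any one of them can be consulted in place of
    the true valuations.

    The exponential cost comes from trimming alone. Adding one agent to an envy-free assignment of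
    trimmed pieces opens a contest, each step of which solves a smaller trimming problem for the
    current winners; a potential made of powers of [3] bounds the whole by [3 ^ n] batches of cuts.
    All that surrounds it is polynomial. A swap leaves a deficit that is small relative to the
    residue, and each of the at most [n] later stages may multiply this ratio by [reserve], which is
    of order [n ^ 2]. So it suffices to shrink the residue by [reserve ^ n.+1], which takes about
    [n ^ 2] halvings. The total, of order [n ^ 8 * 3 ^ n], is within [14 ^ n] up to a constant. *)

Definition seg b x b' y : set R := [set` Interval (BSide b x) (BSide b' y)].

(** The two flags read differently: [true] closes the left end, [false] closes the right end. Thus
    [seg true x false y] is the closed segment. *)
Lemma in_seg b x b' y z :
  seg b x b' y z <-> (x < z ?<= if b) /\ (z < y ?<= if ~~ b').
Proof. by rewrite /seg /= in_itv /=; split=> [/andP|/andP]. Qed.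

Lemma seg_open b x b' y t : x < t -> t < y -> seg b x b' y t.
Proof. by move=> h1 h2; apply/in_seg; split; exact: lteifS. Qed.

Lemma seg_cake b x b' y : 0 <= x -> y <= 1 -> seg b x b' y `<=` cake R.
Proof.
move=> x0 y1 z /in_seg[xz zy]; rewrite /cake /= in_itv /=; apply/andP; split.
- by apply: le_trans x0 _; case: b xz => //= /ltW.
- by apply: le_trans _ y1; case: b' zy => //= /ltW.
Qed.

Lemma subinterval_seg b x b' y : 0 <= x -> y <= 1 -> subinterval (seg b x b' y).
Proof. by move=> x0 y1; exists (Interval (BSide b x) (BSide b' y)); split => //;
  exact: seg_cake. Qed.

Lemma subinterval0 : subinterval (set0 : set R).
Proof.
exists `]0, 0[; split; last by move=> ?.
by apply/seteqP; split => x //=; rewrite in_itv /= => /andP[h1 h2]; have := lt_trans h1 h2;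
  rewrite ltxx.
Qed.

Lemma subinterval_piece A : subinterval A -> piece A.
Proof.
move=> hA; exists 1%N, (fun=> A); split => //.
- by move=> i j _ _ _; rewrite !ord1.
- by apply/seteqP; split => x; [move=> ?; exists ord0|case].
Qed.

Lemma piece0 : piece (set0 : set R).
Proof. exact/subinterval_piece/subinterval0. Qed.

Lemma piece_seg b x b' y : 0 <= x -> y <= 1 -> piece (seg b x b' y).
Proof. by move=> x0 y1; apply/subinterval_piece/subinterval_seg. Qed.

Lemma pieceU A B : piece A -> piece B -> A `&` B = set0 -> piece (A `|` B).
Proof.
move=> [m [I [sI tI ->]]] [k [J [sJ tJ ->]]] AB0.
exists (m + k)%N, (fun i => match fintype.split i with inl j => I j | inr j => J j end).
split.
- by move=> i; case: (fintype.split i).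
- move=> i j _ _; rewrite -[i](@fintype.splitK m k) -[j](@fintype.splitK m k) !fintype.unsplitK.
  case: (fintype.split i) => a; case: (fintype.split j) => c [x [xa xc]].
  + by congr (unsplit (inl _)); apply: tI => //; exists x.
  + by exfalso; rewrite -[False]/(set0 x) -AB0; split; [exists a|exists c].
  + by exfalso; rewrite -[False]/(set0 x) -AB0; split; [exists c|exists a].
  + by congr (unsplit (inr _)); apply: tJ => //; exists x.
- apply/seteqP; split => x.
  + case=> -[i _ xi]; [exists (unsplit (inl i))|exists (unsplit (inr i))] => //;
      by rewrite fintype.unsplitK.
  + by case=> i _; case: (fintype.split i) => j xj; [left|right]; exists j.
Qed.

Lemma piece_sub A : piece A -> A `<=` cake R.
Proof. by move=> [m [I [sI _ ->]]] x [j _]; have [i [-> +]] := sI j; apply. Qed.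

(* Junk endpoints only arise for the empty interval. *)
Lemma subintervalP A : subinterval A -> A !=set0 ->
  exists b x b' y, [/\ A = seg b x b' y, 0 <= x, x <= y & y <= 1].
Proof.
move=> [[[b x|[]] [b' y|[]]] [-> sub]] [z zA].
- exists b, x, b', y; have [xz zy] : (x < z ?<= if b) /\ (z < y ?<= if ~~ b')
    by apply/in_seg.
  have zc := sub _ zA; rewrite /cake /= in_itv /= in zc; case/andP: zc => z0 z1.
  have xz' : x <= z by case: b xz {zA sub} => //= /ltW.
  have zy' : z <= y by case: b' zy {zA sub} => //= /ltW.
  split => //.
  + rewrite leNgt; apply/negP => x0.
    have : cake R (x / 2).
      apply: sub; apply: seg_open; lra.
    by rewrite /cake /= in_itv /= => /andP[]; lra.
  + exact: le_trans xz' zy'.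
  + rewrite leNgt; apply/negP => y1.
    have : cake R ((1 + y) / 2).
      by apply: sub; apply: seg_open; lra.
    by rewrite /cake /= in_itv /= => /andP[]; lra.
- exfalso; move: zA; rewrite /= in_itv /= ?andbF //.
- exfalso; have : cake R (z + 2).
    apply: sub; move: zA; rewrite /= !in_itv /= !andbT.
    by case: b => /=; lra.
  have := sub _ zA; rewrite /cake /= !in_itv /= => /andP[? ?] /andP[]; lra.
- exfalso; have : cake R (z - 2).
    apply: sub; move: zA; rewrite /= !in_itv /=.
    by case: b' => /=; lra.
  have := sub _ zA; rewrite /cake /= !in_itv /= => /andP[? ?] /andP[]; lra.
- by exfalso; move: zA; rewrite /= in_itv.
- exfalso; have : cake R (z - 2) by apply: sub.
  have := sub _ zA; rewrite /cake /= !in_itv /= => /andP[? ?] /andP[]; lra.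
- by exfalso; move: zA; rewrite /= in_itv.
- by exfalso; move: zA; rewrite /= in_itv.
- by exfalso; move: zA; rewrite /= in_itv.
Qed.

Section OneValuation.
Variables (f : set R -> R) (hf : valuation f).

Lemma val0 : f set0 = 0.
Proof.
have := valuation_additive hf piece0 piece0 (setI0 _).
by rewrite setU0; lra.
Qed.

Lemma valU A B : piece A -> piece B -> A `&` B = set0 -> f (A `|` B) = f A + f B.
Proof. exact: valuation_additive. Qed.

Lemma val_ge0 A : piece A -> 0 <= f A.
Proof. exact: valuation_ge0. Qed.

(** A subinterval of a point is empty or the whole point, so divisibility by two leaves only the
    value [0]. *)
Lemma val_set1 x : 0 <= x <= 1 -> f [set x] = 0.
Proof.
move=> /andP[x0 x1]; have sx : subinterval [set x].
  rewrite -set_itv1; exact: (@subinterval_seg true x false x).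
have [|I' [sI' I'x fI']] := valuation_divisible hf sx (lam := 1 / 2); first by lra.
have fx0 := val_ge0 (subinterval_piece sx).
have [I'z|I'0] := pselect (I' !=set0); last first.
  have I'e : I' = set0 by apply/seteqP; split=> t // It; apply: I'0; exists t.
  by move: fI'; rewrite I'e val0; lra.
have I'e : I' = [set x].
  by case: I'z => t It; have tx := I'x _ It; apply/seteqP; split=> // s ->; rewrite -tx.
by move: fI'; rewrite I'e; lra.
Qed.

(** Since points have no value, the value of any segment is a difference of this function, whatever
    its end points. All queries of the protocol concern segments that start at [0]. *)
Definition cdf p := f `[0, p]%classic.

Lemma val_seg_oc x y : 0 <= x -> x <= y -> y <= 1 ->
  f (seg false x false y) = cdf y - cdf x.
Proof.
move=> x0 xy y1; rewrite /cdf.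
have <- : seg true 0 false x `|` seg false x false y = `[0, y]%classic.
  by rewrite /seg -itv_bndbnd_setU // bnd_simp.
rewrite valU; [|apply: piece_seg; lra..|]; first by rewrite /seg; lra.
by apply/seteqP; split=> z //= [/in_seg /= [_ ?] /in_seg /= [? _]]; lra.
Qed.

Lemma val_seg b x b' y : 0 <= x -> x <= y -> y <= 1 -> f (seg b x b' y) = cdf y - cdf x.
Proof.
move=> x0 xy y1.
have oc := val_seg_oc x0 xy y1.
have p1 (z : R) : 0 <= z <= 1 -> piece [set z].
  move=> /andP[z0 z1]; have := @piece_seg true z false z z0 z1; by rewrite /seg set_itv1.
have [xey|xy'] : x = y \/ x < y by move: xy; rewrite le_eqVlt => /orP[/eqP|]; [left|right].
  rewrite xey subrr; case: b b' => -[]; rewrite /seg.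
  + by rewrite set_itvco0 val0.
  + by rewrite set_itv1 val_set1 //; lra.
  + by rewrite set_itvoo0 val0.
  + by rewrite set_itvoc0 val0.
have cc : f (seg true x false y) = cdf y - cdf x.
  rewrite -oc; have -> : seg true x false y = [set x] `|` seg false x false y.
    by rewrite /seg setU1itv // bnd_simp.
  rewrite valU; [|by apply: p1; lra|exact: piece_seg|];
    first by rewrite val_set1 ?add0r //; lra.
  by apply/seteqP; split=> z //= [-> /in_seg /= [? _]]; lra.
have co : forall b, f (seg b x true y) = f (seg b x false y).
  move=> c; have -> : seg c x false y = seg c x true y `|` [set y].
    by rewrite /seg setUitv1 //; case: c; rewrite bnd_simp.
  rewrite valU; [|exact: piece_seg|by apply: p1; lra|];
    first by rewrite val_set1 ?addr0 //; lra.
  by apply/seteqP; split=> z //= [h zy]; move: h; rewrite zy => /in_seg /= [_];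
    rewrite ltxx.
by case: b b' => -[]; rewrite ?co.
Qed.

Lemma cdf0 : cdf 0 = 0.
Proof. by rewrite /cdf set_itv1 val_set1 //; lra. Qed.

Lemma cdf1 : cdf 1 = 1.
Proof. exact: valuation_normalized hf. Qed.

Lemma cdf_le x y : 0 <= x -> x <= y -> y <= 1 -> cdf x <= cdf y.
Proof. by move=> x0 xy y1; have := val_ge0 (@piece_seg false x false y x0 y1);
  rewrite val_seg_oc //; lra. Qed.

Lemma half_seg x y : 0 <= x -> x <= y -> y <= 1 -> cdf x < cdf y ->
  exists p q, [/\ x <= p, p < q, q <= y & cdf q - cdf p = (cdf y - cdf x) / 2].
Proof.
move=> x0 xy y1 lt.
have [|I' [sI' sub fI']] := valuation_divisible hf (@subinterval_seg false x false y x0 y1) (lam := 1 / 2).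
  lra.
rewrite val_seg_oc // in fI'.
have [I'0|I'0] := pselect (I' !=set0); last first.
  have I'e : I' = set0 by apply/seteqP; split=> t // It; apply: I'0; exists t.
  by move: fI'; rewrite I'e val0; lra.
have [b [p [b' [q [Ie p0 pq q1]]]]] := subintervalP sI' I'0.
move: fI'; rewrite Ie val_seg // => fI'.
case: I'0 => z I'z; have := sub _ I'z; rewrite Ie in I'z sub => /in_seg /= [xz zy].
have pq' : p < q.
  by move: pq; rewrite le_eqVlt => /orP[/eqP pq|//]; move: fI'; rewrite pq; lra.
have [pz zq] : p <= z /\ z <= q.
  by move/in_seg: I'z => [h1 h2]; split;
    [case: b h1 {Ie sub}|case: b' h2 {Ie sub}] => //= /ltW.
exists p, q; split=> //; last by lra.
- rewrite leNgt; apply/negP => px.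
  have /sub /in_seg /= [] : seg b p b' q x by apply: seg_open; lra.
  lra.
- rewrite leNgt; apply/negP => yq.
  have /sub /in_seg /= [] : seg b p b' q ((y + q) / 2) by apply: seg_open; lra.
  lra.
Qed.

(* If the distribution function jumped by [delta] at [s], a short interval ending at
   [s] would have a value in [[delta, 3/2 delta)], and a subinterval would be worth
   at least [delta] or less than [delta / 2]: none would be worth half of it. *)
Lemma cdf_surj (g : R) : 0 <= g <= 1 -> exists p, 0 <= p <= 1 /\ cdf p = g.
Proof.
move=> /andP[g0 g1]; apply: contrapT => no.
have neq p : 0 <= p -> p <= 1 -> cdf p <> g by move=> p0 p1 e; apply: no; exists p;
  rewrite p0.
pose S := [set p | 0 <= p <= 1 /\ cdf p <= g]; pose s := sup S.
have S0 : S 0 by rewrite /S /= cdf0; split=> //; lra.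
have supS : has_sup S.
  by split; [exists 0|exists 1 => p [/andP[]]].
have Sub p : S p -> p <= s by move=> Sp; apply: ub_le_sup => //; case: supS.
have s0 : 0 <= s by exact: Sub.
have s1 : s <= 1 by apply: ge_sup; [exists 0|move=> p [/andP[]]].
have above p : s < p -> p <= 1 -> g < cdf p.
  move=> sp p1; rewrite ltNge; apply/negP => pg.
  suff /Sub : S p by lra.
  by split=> //; lra.
have below p : 0 <= p -> p < s -> cdf p < g.
  move=> p0 ps; have [q [/andP[q0 q1] qg] pq] := sup_adherent (eps :=
    s - p) ltac:(lra) supS.
  have qle : cdf q < g by rewrite lt_neqAle qg andbT; apply/eqP/neq.
  by apply: le_lt_trans qle; apply: cdf_le => //; rewrite /s in pq *; lra.
have [lt|gt] : cdf s < g \/ g < cdf s.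
- by have := neq _ s0 s1; case: (ltgtP (cdf s) g); auto.
- have s1' : s < 1 by rewrite lt_neqAle s1 andbT; apply/eqP => e; move: lt; rewrite e cdf1;
    lra.
  (* The mirror case, a jump just to the right of [s]: [inf E] is the right limit of [cdf], and the
     short interval now starts at [s]. *)
  pose E := [set cdf p | p in [set p | s < p <= 1]].
  have infE : has_inf E.
    split; first by exists (cdf 1), 1 => //=; lra.
    by exists g => _ [p /andP[sp p1] <-]; exact/ltW/above.
  have gi : g <= inf E by apply: lb_le_inf; [case: infE|move=> _ [p /andP[sp p1] <-];
    exact/ltW/above].
  have iE p : s < p -> p <= 1 -> inf E <= cdf p.
    by move=> sp p1; apply: ge_inf; [case: infE|exists p => //=; lra].
  have [_ [p /= /andP[sp p1] <-] pi] := inf_adherent (eps :=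
    (inf E - cdf s) / 2) ltac:(lra) infE.
  have ip := iE _ sp p1.
  have [||u [w [su uw wp e]]] := @half_seg s p s0 _ p1; [lra|lra|].
  have iw := iE w ltac:(lra) ltac:(lra).
  have wl := @cdf_le w p ltac:(lra) wp p1.
  have [us|us] : u = s \/ s < u by move: su; rewrite le_eqVlt => /orP[/eqP|]; auto.
    by move: e; rewrite us; lra.
  have iu := iE u us ltac:(lra); lra.
- have s0' : 0 < s by rewrite lt_neqAle s0 andbT; apply/eqP => e; move: gt;
    rewrite -e cdf0; lra.
  pose E := [set cdf p | p in [set p | 0 <= p < s]].
  have supE : has_sup E.
    split; first by exists (cdf 0), 0 => //=; lra.
    by exists g => _ [p /andP[sp p1] <-]; exact/ltW/below.
  have gi : sup E <= g by apply: ge_sup; [case: supE|move=> _ [p /andP[sp p1] <-];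
    exact/ltW/below].
  have iE p : 0 <= p -> p < s -> cdf p <= sup E.
    by move=> sp p1; apply: ub_le_sup; [case: supE|exists p => //=; lra].
  have [_ [p /= /andP[p0 ps] <-] pi] := sup_adherent (eps :=
    (cdf s - sup E) / 2) ltac:(lra) supE.
  have ip := iE _ p0 ps.
  have [||u [w [pu uw ws e]]] := @half_seg p s p0 _ s1; [lra|lra|].
  have iu := iE u ltac:(lra) ltac:(lra).
  have ul := @cdf_le p u p0 pu ltac:(lra).
  have [us|us] : w = s \/ w < s by move: ws; rewrite le_eqVlt => /orP[/eqP|]; auto.
    by move: e; rewrite us; lra.
  have iw := iE w ltac:(lra) us; lra.
Qed.

End OneValuation.
End Valuations.

(** * Query strategies *)

Section Reach.
Local Open Scope classical_set_scope.
Local Open Scope ring_scope.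

Variables (R : realType) (V : finType).
Local Notation prof := (V -> set R -> R).
Implicit Types (K : set prof) (G : set prof -> Prop) (q : nat) (p : R).

(* [K] is the set of profiles that agree with the answers received so far;
   [reach G q K] means that at most [q] further queries turn [K] into a set
   satisfying [G], whatever the answers. *)
Inductive reach G : nat -> set prof -> Prop :=
| reach_done q K : (K !=set0 -> G K) -> reach G q K
| reach_eval q K v p : 0 <= p <= 1 ->
    (forall a, reach G q (K `&` [set f | cdf (f v) p = a])) -> reach G q.+1 K
| reach_cut q K v a :
    (forall f, K f -> exists y, cut_answer (f v) 0 a y) ->
    (forall y, reach G q (K `&` [set f | cut_answer (f v) 0 a y])) ->
    reach G q.+1 K.

(** Contradictory answers call for no further query. So a strategy may fix one profile [f0] of [K]
    and branch on its values, provided that they are common to all of [K]. *)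
Lemma reach_nonempty G q K : (K !=set0 -> reach G q K) -> reach G q K.
Proof.
by move=> h; have [K0|K0] := pselect (K !=set0); [exact: h|exact: reach_done].
Qed.

Lemma reach_le G q q' K : (q <= q')%N -> reach G q K -> reach G q' K.
Proof.
move=> + r; elim: r q' => {q K} [q K h|q K v p p01 _ IH|q K v a ha _ IH] [|q'] // qq'.
- exact: reach_done.
- exact: reach_done.
- by apply: (reach_eval (v := v) p01) => b; exact: IH.
- by apply: (reach_cut ha) => y; exact: IH.
Qed.

Lemma reach_bind G G' q q' K : reach G' q K ->
  (forall K', K' `<=` K -> K' !=set0 -> G' K' -> reach G q' K') ->
  reach G (q + q') K.
Proof.
elim=> {q K} [q K h|q K v p p01 _ IH|q K v a ha _ IH] cont.
- apply: reach_nonempty => K0; apply: (reach_le (leq_addl q q')).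
  by apply: cont => //; exact: h.
- rewrite addSn; apply: (reach_eval (v := v) p01) => b; apply: IH => K' sub.
  by apply: cont => f /sub [].
- rewrite addSn; apply: (reach_cut ha) => y; apply: IH => K' sub.
  by apply: cont => f /sub [].
Qed.

Lemma reach_weaken G G' q q' K : reach G' q K -> (q <= q')%N ->
  (forall K', K' `<=` K -> K' !=set0 -> G' K' -> G K') -> reach G q' K.
Proof.
move=> r qq' h; rewrite -(subnKC qq').
by apply: (reach_bind r) => K' sub K'0 G'K'; apply: reach_done => _; exact: h.
Qed.

(** The continuation of a query is chosen separately for each answer; an impossible answer leaves no
    profile, and then any output will do. *)
Lemma reach_protocol (Post : prof -> (V -> set R) -> Prop) G q K : reach G q K ->
  (forall K', K' `<=` K -> K' !=set0 -> G K' ->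
     exists A, forall f, K' f -> Post f A) ->
  exists P : protocol R V, forall f, K f ->
    legal f P /\ forall q' A, run f P q' A -> Post f A /\ (q' <= q)%N.
Proof.
elim=> {q K} [q K h|q K v p /andP[p0 p1] _ IH|q K v a ha _ IH] post.
- have [K0|K0] := pselect (K !=set0); last first.
    by exists (Output (fun=> set0)) => f Kf; exfalso; apply: K0; exists f.
  have [A hA] := post K (@subset_refl _ _) K0 (h K0).
  exists (Output A) => f Kf; split=> // q' B r; inversion r; subst.
  by split=> //; exact: hA.
- have /choice[P hP] : forall b, exists P : protocol R V, forall f,
      (K `&` [set f | cdf (f v) p = b]) f ->
      legal f P /\ forall q' A, run f P q' A -> Post f A /\ (q' <= q)%N.
    by move=> b; apply: IH => K' sub; apply: post => f /sub [].
  exists (EvalQuery v 0 p P) => f Kf.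
  have [leg hr] := hP (f v `[0, p]%classic) f (conj Kf erefl).
  split=> [|q' A r]; first by split.
  by inversion r as [|v' x y k q1 B r'|]; subst; case: (hr _ _ r').
- have /choice[P hP] : forall y, exists P : protocol R V, forall f,
      (K `&` [set f | cut_answer (f v) 0 a y]) f ->
      legal f P /\ forall q' A, run f P q' A -> Post f A /\ (q' <= q)%N.
    by move=> b; apply: IH => K' sub; apply: post => f /sub [].
  exists (CutQuery v 0 a P) => f Kf; split=> [|q' A r].
    split; [by rewrite lexx ler01|exact: ha|].
    by move=> y cy; case: (hP y f (conj Kf cy)).
  inversion r as [| |v' x a' k y q1 B cy r']; subst.
  by have [_ /(_ _ _ r')[]] := hP y f (conj Kf cy).
Qed.

Definition profiles : set prof := [set f | forall v, valuation (f v)].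

(** This asks for the values of all agents, not only of the one who cut at [p]: later comparisons by
    any agent then need no further query. *)
Definition known K p := 0 <= p <= 1 /\
  forall f g, K f -> K g -> forall v, cdf (f v) p = cdf (g v) p.

Lemma known_sub K K' p : K' `<=` K -> known K p -> known K' p.
Proof. by move=> sub [p01 h]; split=> // f g /sub Kf /sub Kg; exact: h. Qed.

Lemma reach_known K p : 0 <= p <= 1 -> reach (fun K' => known K' p) #|V| K.
Proof.
move=> p01; rewrite cardE.
have : reach (fun K' => forall f g, K' f -> K' g ->
    forall v, v \in enum V -> cdf (f v) p = cdf (g v) p) (size (enum V)) K.
  elim: (enum V) K => [|v s IH] K; first by apply: reach_done.
  apply: (reach_eval (v := v) p01) => b; apply: reach_weaken (IH _) _ _ => //.
  move=> K' sub _ h f g Kf Kg w; rewrite inE => /orP[/eqP ->|]; last exact: h.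
  by have [_ /= ->] := sub _ Kf; have [_ /= ->] := sub _ Kg.
move=> r; apply: (reach_weaken r) => // K' _ _ h; split=> // f g Kf Kg v.
by apply: h => //; rewrite mem_enum.
Qed.

Lemma reach_cut_known K v (a : R) : K `<=` profiles -> 0 <= a <= 1 ->
  reach (fun K' => exists p, known K' p /\ forall f, K' f -> cdf (f v) p = a) #|V|.+1 K.
Proof.
move=> KV a01; apply: (reach_cut (v := v) (a := a)) => [f /KV fV|y].
  by have [p [p01 pa]] := cdf_surj (fV v) a01; exists p.
apply: reach_nonempty => -[f0 [Kf0 [y01 _]]].
apply: (reach_weaken (reach_known _ y01)) => // K' sub _ kny.
by exists y; split=> // f /sub [_ []].
Qed.

End Reach.

(** * Pieces of known value *)

Section Known.
Local Open Scope classical_set_scope.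
Local Open Scope ring_scope.

Variables (R : realType) (V : finType).
Local Notation prof := (V -> set R -> R).
Local Notation cdf := (@cdf R).
Implicit Types (K : set prof) (G : set prof -> Prop) (q : nat) (p : R) (A B S : set R).

(** The pieces that the answers determine: all profiles of [K] give them the same value
    ([kpiece_det]), and the class is stable under cutting at a known point. *)
Inductive kpiece K : set R -> Prop :=
| kpiece0 : kpiece K set0
| kpieceS b x b' y A : known K x -> known K y -> x <= y -> kpiece K A ->
    seg b x b' y `&` A = set0 -> kpiece K (seg b x b' y `|` A).

Definition pre A p := A `&` [set x | x <= p].
Definition post A p := A `&` [set x | p < x].

Lemma setI0_intro (T : Type) (A B : set T) : (forall x, A x -> B x -> False) ->
  A `&` B = set0.
Proof. by move=> h; apply/seteqP; split=> x // [/h]; apply. Qed.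

Lemma setI0_elim (T : Type) (A B : set T) x : A `&` B = set0 -> A x -> B x -> False.
Proof. by move=> e Ax Bx; rewrite -[False]/(set0 x) -e. Qed.

Lemma kpiece_sub K K' A : K' `<=` K -> kpiece K A -> kpiece K' A.
Proof.
by move=> sub; elim=> [|b x b' y A' kx ky xy _ IH d]; [exact: kpiece0|apply: kpieceS => //;
  exact: known_sub sub _].
Qed.

Lemma kpiece_piece K A : kpiece K A -> piece A.
Proof.
elim=> [|b x b' y A' [/andP[x0 _] _] [/andP[_ y1] _] xy _ IH d]; first exact: piece0.
by apply: pieceU => //; exact: piece_seg.
Qed.

Lemma kpieceU K A B : kpiece K A -> kpiece K B -> A `&` B = set0 -> kpiece K (A `|` B).
Proof.
move=> + dB; elim=> [|b x b' y A' kx ky xy _ IH d]; first by rewrite set0U.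
move=> dAB; rewrite -setUA; apply: kpieceS => //.
  by apply: IH; apply: setI0_intro => z h1 h2; apply: (setI0_elim dAB _ h2); right.
apply: setI0_intro => z h1 [h2|h2]; first exact: (setI0_elim d h1 h2).
by apply: (setI0_elim dAB _ h2); left.
Qed.

Lemma kpiece_seg K b x b' y : known K x -> known K y -> x <= y -> kpiece K (seg b x b' y).
Proof. by move=> kx ky xy; rewrite -[seg _ _ _ _]setU0;
  apply: kpieceS (kpiece0 _) (setI0 _). Qed.

Lemma kpiece_seg_pre K b x b' y p : known K x -> known K y -> x <= y -> known K p ->
  kpiece K (pre (seg b x b' y) p).
Proof.
move=> kx ky xy kp; have [px|xp] := ltP p x.
  suff -> : pre (seg b x b' y) p = set0 by exact: kpiece0.
  by apply: setI0_intro => z /in_seg [h _] /= zp; case: b h => /=; lra.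
have [yp|py] := leP y p.
  suff -> : pre (seg b x b' y) p = seg b x b' y by exact: kpiece_seg.
  apply/seteqP; split=> z; first by case.
  by move=> h; split=> //=; move/in_seg: h => [_ h]; case: b' h => /=; lra.
suff -> : pre (seg b x b' y) p = seg b x false p by exact: kpiece_seg.
apply/seteqP; split=> z; first by move=> [/in_seg[h _] zp]; apply/in_seg.
move=> /in_seg /= [h zp]; split=> //; apply/in_seg; split=> //; apply: lteifS; lra.
Qed.

Lemma kpiece_seg_post K b x b' y p : known K x -> known K y -> x <= y -> known K p ->
  kpiece K (post (seg b x b' y) p).
Proof.
move=> kx ky xy kp; have [px|xp] := ltP p x.
  suff -> : post (seg b x b' y) p = seg b x b' y by exact: kpiece_seg.
  apply/seteqP; split=> z; first by case.
  by move=> h; split=> //=; move/in_seg: h => [h _]; case: b h => /=; lra.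
have [yp|py] := leP y p.
  suff -> : post (seg b x b' y) p = set0 by exact: kpiece0.
  by apply: setI0_intro => z /in_seg [_ h] /= zp; case: b' h => /=; lra.
suff -> : post (seg b x b' y) p = seg false p b' y by apply: kpiece_seg => //; exact: ltW.
apply/seteqP; split=> z; first by move=> [/in_seg[_ h] zp]; apply/in_seg.
move=> /in_seg /= [h zp]; split=> //; apply/in_seg; split=> //; apply: lteifS; lra.
Qed.

Lemma kpiece_pre K A p : known K p -> kpiece K A -> kpiece K (pre A p).
Proof.
move=> kp; elim=> [|b x b' y A' kx ky xy _ IH d]; first by rewrite /pre set0I;
  exact: kpiece0.
rewrite /pre setIUl; apply: kpieceU => //; first exact: kpiece_seg_pre.
by apply: setI0_intro => z [h1 _] [h2 _]; exact: setI0_elim d h1 h2.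
Qed.

Lemma kpiece_post K A p : known K p -> kpiece K A -> kpiece K (post A p).
Proof.
move=> kp; elim=> [|b x b' y A' kx ky xy _ IH d]; first by rewrite /post set0I;
  exact: kpiece0.
rewrite /post setIUl; apply: kpieceU => //; first exact: kpiece_seg_post.
by apply: setI0_intro => z [h1 _] [h2 _]; exact: setI0_elim d h1 h2.
Qed.

(** When no profile is left, every point is known. Facts about a piece cut at an arbitrary point, of
    whatever status, thus follow from the lemmas on [kpiece] taken at [K := set0]. *)
Lemma known_set0 p : 0 <= p <= 1 -> known (set0 : set prof) p.
Proof. by move=> p01; split. Qed.

Lemma kpiece_set0 K A : kpiece K A -> kpiece set0 A.
Proof. exact: kpiece_sub. Qed.

Lemma prepostU A p : pre A p `|` post A p = A.
Proof.
rewrite /pre /post -setIUr; apply/setIidPl => x _ /=.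
by case: (leP x p); [left|right].
Qed.

Lemma prepostI A B p : pre A p `&` post B p = set0.
Proof. by apply: setI0_intro => x [_ /= h] [_ /=]; lra. Qed.

Section Values.
Variables (f : set R -> R) (hf : valuation f).

Lemma kvalU K A B : kpiece K A -> kpiece K B -> A `&` B = set0 ->
  f (A `|` B) = f A + f B.
Proof. by move=> /kpiece_piece pA /kpiece_piece pB; exact: valU. Qed.

Lemma kval_ge0 K A : kpiece K A -> 0 <= f A.
Proof. by move/kpiece_piece; exact: val_ge0. Qed.

Lemma kval_pre_post K A p : kpiece K A -> 0 <= p <= 1 -> f A = f (pre A p) + f (post A p).
Proof.
move=> /kpiece_set0 dA /known_set0 kp; rewrite -(kvalU (K := set0)) ?prepostU //.
- exact: kpiece_pre.
- exact: kpiece_post.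
- exact: prepostI.
Qed.

Lemma pre_pre A p p' : p <= p' -> pre (pre A p') p = pre A p.
Proof.
move=> pp'; apply/seteqP; split=> x; first by case=> -[].
by move=> [Ax /= xp]; do 2?split=> //=; exact: le_trans xp pp'.
Qed.

Lemma pre_le K A p p' : kpiece K A -> 0 <= p -> p <= p' -> p' <= 1 ->
  f (pre A p) <= f (pre A p').
Proof.
move=> /kpiece_set0 dA p0 pp' p1; have kp : known (set0 : set prof) p by apply: known_set0;
  lra.
have kp' : known (set0 : set prof) p' by apply: known_set0; lra.
rewrite (@kval_pre_post set0 (pre A p') p) ?pre_pre //; last by lra.
  by rewrite lerDl; apply: (@kval_ge0 set0); apply: kpiece_post => //; exact: kpiece_pre.
exact: kpiece_pre.
Qed.

Lemma kpiece_cakeP K A : kpiece K A -> forall x, A x -> 0 <= x <= 1.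
Proof. by move=> /kpiece_piece /piece_sub sub x /sub; rewrite /cake /= in_itv. Qed.

Lemma pre1 K A : kpiece K A -> pre A 1 = A.
Proof. by move=> dA; apply/setIidPl => x Ax /=; have /andP[] := kpiece_cakeP dA Ax. Qed.

Lemma kval_sub1 K A x : kpiece K A -> 0 <= x <= 1 -> A `<=` [set x] -> f A = 0.
Proof.
move=> dA x01 sub; have [Ax|Ax] := pselect (A x).
  suff -> : A = [set x] by exact: val_set1.
  by apply/seteqP; split=> // z ->.
suff -> : A = set0 by exact: val0.
by apply/seteqP; split=> z // Az; apply: Ax; rewrite -(sub _ Az).
Qed.

Lemma pre0 K A : kpiece K A -> f (pre A 0) = 0.
Proof.
move=> dA; have k0 : known (set0 : set prof) 0 by apply: known_set0; lra.
apply: (@kval_sub1 set0 _ 0); [|lra|]; first exact/kpiece_pre/kpiece_set0/dA.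
by move=> x [Ax /= x0]; have /andP[? ?] := kpiece_cakeP dA Ax; apply/eqP; rewrite eq_le x0.
Qed.

Lemma val_pre_seg b (x : R) b' (y : R) p : 0 <= x -> x <= y -> y <= 1 -> 0 <= p <= 1 ->
  f (pre (seg b x b' y) p) = cdf f (Num.max x (Num.min p y)) - cdf f x.
Proof.
move=> x0 xy y1 p01; have [px|xp] := leP p x.
  have -> : Num.min p y = p by apply/min_idPl; lra.
  have -> : Num.max x p = x by apply/max_idPl.
  rewrite subrr; apply: (@kval_sub1 set0 _ x); [|lra|].
    by apply: kpiece_seg_pre => //; apply: known_set0; lra.
  by move=> z [/in_seg[h _] /= zp]; apply/eqP; rewrite eq_le; apply/andP; split;
    case: b h => /=; lra.
have [yp|py] := leP y p.
  have -> : Num.max x y = y by apply/max_idPr.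
  rewrite -(@val_seg _ f hf b x b' y) //; congr f.
  by apply/setIidPl => z /in_seg[_ h] /=; case: b' h => /=; lra.
have -> : Num.max x p = p by apply/max_idPr; lra.
rewrite -(@val_seg _ f hf b x false p) //; [|lra..]; congr f.
apply/seteqP; split=> z; first by move=> [/in_seg[h _] /= zp]; apply/in_seg.
move=> /in_seg /= [h zp]; split=> //; apply/in_seg; split=> //; apply: lteifS; lra.
Qed.

End Values.

Lemma kpiece_det K A f g v : K `<=` profiles (R:=R) (V:=V) -> kpiece K A -> K f -> K g ->
  f v A = g v A.
Proof.
move=> KV dA Kf Kg; have hf := KV _ Kf v; have hg := KV _ Kg v.
elim: dA => [|b x b' y A' kx ky xy dA' IH d]; first by rewrite !val0.
have ds : kpiece K (seg b x b' y) by exact: kpiece_seg.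
rewrite (kvalU hf ds dA' d) (kvalU hg ds dA' d) IH.
case: kx ky ds => /andP[x0 x1] hx [/andP[y0 y1] hy] ds.
by rewrite !val_seg // (hx _ _ Kf Kg) (hy _ _ Kf Kg).
Qed.

Lemma known_max K p p' : known K p -> known K p' -> known K (Num.max p p').
Proof. by move=> kp kp'; case: (leP p p'). Qed.

Lemma known_min K p p' : known K p -> known K p' -> known K (Num.min p p').
Proof. by move=> kp kp'; case: (leP p p'). Qed.

Lemma pre_setU A B p : pre (A `|` B) p = pre A p `|` pre B p.
Proof. exact: setIUl. Qed.

(* As a function of [p], the value of [pre A p] is piecewise constant or a
   translate of the cumulative distribution function, with known breakpoints. *)
Lemma kpiece_segment K A (f0 : set R -> R) d c a : valuation f0 ->
  kpiece K A -> known K d -> known K c -> d <= c ->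
  f0 (pre A d) <= a <= f0 (pre A c) ->
  exists x y, [/\ known K x, known K y, [/\ d <= x, x <= y & y <= c],
    f0 (pre A x) <= a <= f0 (pre A y) &
    (forall g, valuation g -> forall p, x <= p <= y ->
       g (pre A p) = g (pre A x) + (cdf g p - cdf g x)) \/
    (forall g, valuation g -> forall p, x <= p <= y -> g (pre A p) = g (pre A x))].
Proof.
move=> hf0 dA; elim: dA d c a => [|b x b' y A' kx ky xy dA' IH disjA'] d c a kd kc dc.
  move=> h; exists d, c; split=> //; right=> g _ p _; by rewrite /pre !set0I.
set I := seg b x b' y.
have dI : kpiece K I by exact: kpiece_seg.
have [/andP[x0 x1] _] := kx; have [/andP[y0 y1] _] := ky.
have [/andP[d0 d1] _] := kd; have [/andP[c0 c1] _] := kc.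
have FE g p : valuation g -> 0 <= p <= 1 ->
  g (pre (I `|` A') p) = g (pre I p) + g (pre A' p).
  move=> hg p01; have kp := known_set0 p01; rewrite pre_setU (kvalU hg (K := set0)) //.
  - by apply: kpiece_pre => //; exact: kpiece_set0 dI.
  - by apply: kpiece_pre => //; exact: kpiece_set0 dA'.
  - by apply: setI0_intro => z [h1 _] [h2 _]; exact: setI0_elim disjA' h1 h2.
have constI g u w : valuation g -> d <= u -> w <= c -> (w <= x \/ y <= u) ->
  forall p, u <= p <= w -> g (pre I p) = g (pre I u).
  move=> hg du wc h p /andP[up pw]; rewrite !val_pre_seg //; [|lra..].
  case: h => h.
    have -> : Num.min p y = p by apply/min_idPl; lra.
    have -> : Num.min u y = u by apply/min_idPl; lra.
    by have [/max_idPl -> /max_idPl ->] : p <= x /\ u <= x by lra.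
  by have [/min_idPr -> /min_idPr ->] : y <= p /\ y <= u by lra.
have side u w : known K u -> known K w -> d <= u -> u <= w -> w <= c ->
  (w <= x \/ y <= u) ->
    f0 (pre (I `|` A') u) <= a <= f0 (pre (I `|` A') w) ->
    exists x0 y0, [/\ known K x0, known K y0, [/\ d <= x0, x0 <= y0 & y0 <= c],
    f0 (pre (I `|` A') x0) <= a <= f0 (pre (I `|` A') y0) &
    (forall g, valuation g -> forall p, x0 <= p <= y0 ->
       g (pre (I `|` A') p) = g (pre (I `|` A') x0) + (cdf g p - cdf g x0)) \/
    (forall g, valuation g -> forall p, x0 <= p <= y0 ->
      g (pre (I `|` A') p) = g (pre (I `|` A') x0))].
  move=> ku kw du uw wc hside ha.
  have cI := fun g hg => constI g u w hg du wc hside.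
  have E g p : valuation g -> u <= p <= w ->
    g (pre (I `|` A') p) = g (pre I u) + g (pre A' p).
    by move=> hg pu; rewrite FE // ?cI //; lra.
  rewrite !E // in ha; [|lra..].
  have [|x2 [y2 [kx2 ky2 [ux2 xy2 yw2] ha2 alt]]] := IH u w (a - f0 (pre I u)) ku kw uw;
    first by lra.
  exists x2, y2; split=> //; [by split; lra|by rewrite !E //; lra|].
  case: alt => alt; [left|right] => g hg p hp; rewrite !E //; try lra.
  - by rewrite (alt g hg p hp); lra.
  - by rewrite (alt g hg p hp).
move=> /andP[ha1 ha2].
(* The ends of the segment, clipped to [[d, c]]. If the value [a] is reached before [x'] or after
   [y'], the segment contributes a constant there and the induction hypothesis applies to [A']
   through [side]; in between, only the segment grows. *)
pose x' := Num.max d (Num.min x c); pose y' := Num.max d (Num.min y c).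
have kx' : known K x' by apply: known_max => //; exact: known_min.
have ky' : known K y' by apply: known_max => //; exact: known_min.
have [dx' x'c dy' y'c] : [/\ d <= x', x' <= c, d <= y' & y' <= c].
  by rewrite /x' /y' !le_max !ge_max !lexx dc !ge_min !lexx !orbT.
have x'y' : x' <= y' by rewrite /x' /y'; case: (leP x c); case: (leP y c) => ? ?;
  rewrite !ge_max !le_max !lexx; lra.
have [h1|h1] := leP a (f0 (pre (I `|` A') x')).
  have [x'x|x'x] := leP x' x.
    by apply: (side d x') => //; [left|rewrite ha1 h1].
  have x'd : x' = d by move: x'x; rewrite /x'; case: (leP x c); case: (leP d _); lra.
  exists d, d; split=> //; first by rewrite ha1 /=; move: h1; rewrite x'd.
  by right=> g hg p dp; have -> : p = d by lra.
have [h2|h2] := leP (f0 (pre (I `|` A') y')) a.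
  have [yy'|yy'] := leP y y'.
    by apply: (side y' c) => //; [right|rewrite h2 ha2].
  have y'e : y' = c by move: yy'; rewrite /y'; case: (leP y c); case: (leP d _); lra.
  exists c, c; split=> //; first by rewrite ha2 andbT; move: h2; rewrite y'e.
  by right=> g hg p dp; have -> : p = c by lra.
have xx' : x <= x'.
  rewrite leNgt; apply/negP => x'x; have e : x' = c.
    by move: x'x; rewrite /x'; case: (leP x c); case: (leP d _); lra.
  have e' : y' = x' by lra.
  by move: h1 h2; rewrite e'; lra.
have y'y : y' <= y.
  rewrite leNgt; apply/negP => y'x; have e : y' = d.
    by move: y'x; rewrite /y'; case: (leP y c); case: (leP d _); lra.
  have e' : y' = x' by lra.
  by move: h1 h2; rewrite e'; lra.
exists x', y'; split=> //; first by rewrite !ltW.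
left=> g hg p /andP[x'p py'].
have p01 : 0 <= p <= 1 by lra.
have x'01 : 0 <= x' <= 1 by lra.
have clip z : x' <= z -> z <= y' -> Num.max x (Num.min z y) = z.
  move=> h3 h4; have /min_idPl -> : z <= y by lra.
  by apply/max_idPr; lra.
rewrite !FE // !val_pre_seg // !clip //.
(* Being disjoint from the segment, [A'] can meet the part of [[x', p]] after [x'] only at the point
   [y], which has no value. *)
suff -> : g (pre A' p) = g (pre A' x') by lra.
have dA'p : kpiece set0 (pre A' p) by apply: kpiece_pre;
  [exact: known_set0|exact: kpiece_set0 dA'].
have dA'px : kpiece set0 (post (pre A' p) x') by apply: kpiece_post => //;
  exact: known_set0.
have y01 : 0 <= y <= 1 by lra.
rewrite (kval_pre_post hg dA'p x'01) pre_pre // (kval_sub1 hg dA'px y01) ?addr0 //.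
move=> z [[A'z /= zp] /= x'z]; apply: contrapT => /eqP zy.
apply: (setI0_elim disjA' _ A'z); apply: seg_open; first by lra.
by rewrite lt_neqAle zy; lra.
Qed.

Lemma reach_pre K A v d c a : K `<=` profiles (R:=R) (V:=V) -> kpiece K A ->
  known K d -> known K c -> d <= c ->
  (forall f, K f -> f v (pre A d) <= a <= f v (pre A c)) ->
  reach (fun K' => exists t, [/\ known K' t, d <= t <= c &
     forall f, K' f -> f v (pre A t) = a]) #|V|.+1 K.
Proof.
move=> KV dA kd kc dc ha; apply: reach_nonempty => -[f0 Kf0].
have [x [y [kx ky [dx xy yc] hxy alt]]] :=
  kpiece_segment (KV _ Kf0 v) dA kd kc dc (ha _ Kf0).
have det f z : K f -> known K z -> f v (pre A z) = f0 v (pre A z).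
  by move=> Kf kz; apply: (kpiece_det v KV _ Kf Kf0); exact: kpiece_pre.
have [/andP[x0 x1] hx] := kx; have [/andP[y0 y1] hy] := ky.
case: alt => alt; last first.
  have e : f0 v (pre A y) = f0 v (pre A x) by apply: alt; [exact: KV|rewrite xy lexx].
  apply: reach_done => _; exists x; split=> //; first by rewrite dx (le_trans xy).
  by move=> f Kf; rewrite det //; lra.
have e : f0 v (pre A y) = f0 v (pre A x) + (cdf (f0 v) y - cdf (f0 v) x).
  by apply: alt; [exact: KV|rewrite xy lexx].
(* On [[x, y]] the value of [pre A p] is a translate of [cdf], so the target [a] becomes the target
   [g] of a cut query from [0]. *)
pose g := a - f0 v (pre A x) + cdf (f0 v) x.
have cx := cdf_le (KV _ Kf0 v) (lexx 0) x0 x1; rewrite cdf0 in cx; last exact: KV.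
have cy := cdf_le (KV _ Kf0 v) y0 y1 (lexx 1); rewrite cdf1 in cy; last exact: KV.
have g01 : 0 <= g <= 1 by rewrite /g; lra.
apply: (reach_weaken (reach_cut_known v KV g01)) => // K' sub _ [p [kp hp]].
(* The answer [p] may fall outside [[x, y]] when the density vanishes near an end. Then [cdf] is
   constant from [p] to that end, and clipping keeps the value [g]. *)
exists (Num.max x (Num.min p y)).
have kx' := known_sub sub kx; have ky' := known_sub sub ky.
have kt : known K' (Num.max x (Num.min p y)) by apply: known_max => //; exact: known_min.
have xt : x <= Num.max x (Num.min p y) <= y
  by rewrite le_max lexx ge_max xy ge_min lexx orbT.
split=> //; first by lra.
move=> f K'f; have Kf := sub _ K'f; rewrite (alt _ (KV _ Kf v)) // det //.
suff -> : cdf (f v) (Num.max x (Num.min p y)) = g by rewrite (hx _ _ Kf Kf0) /g; lra.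
have hf := KV _ Kf v; have [/andP[p0 p1] _] := kp.
have gx : cdf (f v) x <= g by rewrite (hx _ _ Kf Kf0) /g; lra.
have gy : g <= cdf (f v) y by rewrite (hy _ _ Kf Kf0) /g; lra.
have hp' := hp _ K'f; case: (leP p y) => py; case: (leP x _) => // xp.
- by have := cdf_le hf p0 (ltW xp) x1; lra.
- by have := cdf_le hf y0 (ltW py) p1; lra.
- by lra.
Qed.

Lemma known0 K : K `<=` profiles (R:=R) (V:=V) -> known K 0.
Proof. by move=> KV; split=> [|f g /KV hf /KV hg v]; [lra|rewrite !cdf0]. Qed.

Lemma known1 K : K `<=` profiles (R:=R) (V:=V) -> known K 1.
Proof. by move=> KV; split=> [|f g /KV hf /KV hg v]; [lra|rewrite !cdf1]. Qed.

Lemma kpiece_cake K : K `<=` profiles (R:=R) (V:=V) -> kpiece K (cake R).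
Proof. by move=> KV; apply: (@kpiece_seg K true 0 false 1);
  [exact: known0|exact: known1|lra]. Qed.

End Known.

(** * Colorings *)

Section Colorings.
Local Open Scope classical_set_scope.
Local Open Scope ring_scope.

Variables (R : realType) (V : finType).
Local Notation prof := (V -> set R -> R).
Local Notation profiles := (profiles (R:=R) (V:=V)).
Implicit Types (K : set prof) (p : R) (A B S : set R).

(** Partial allocations are colorings of the points: disjointness of the shares is automatic, and
    merging or permuting shares is composition with a map on colors. *)
Definition cls (T : Type) S (chi : R -> T) t : set R := S `&` [set x | chi x = t].

Definition part K (T : Type) S (chi : R -> T) := forall t, kpiece K (cls S chi t).

Lemma part_sub K K' T S (chi : R -> T) : K' `<=` K -> part K S chi -> part K' S chi.
Proof. by move=> sub h t; exact: kpiece_sub sub (h t). Qed.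

Lemma part_seq K (T : eqType) S (chi : R -> T) (s : seq T) : uniq s -> part K S chi ->
  kpiece K (S `&` [set x | chi x \in s]) /\
  forall f, valuation f -> f (S `&` [set x | chi x \in s]) = \sum_(t <- s) f (cls S chi t).
Proof.
move=> + h; elim: s => [_|t s IH /= /andP[ts us]].
  have -> : S `&` [set x | chi x \in [::]] = set0 by apply: setI0_intro => x _.
  by split; [exact: kpiece0|move=> f hf; rewrite big_nil val0].
have [ds fs] := IH us.
have -> : S `&` [set x | chi x \in t :: s] = cls S chi t `|` S `&` [set x | chi x \in s].
  apply/seteqP; split=> x.
    by move=> [Sx /=]; rewrite inE => /orP[/eqP|]; [left|right].
  by case=> -[Sx /= h']; split=> //=; rewrite inE h' ?eqxx ?orbT.
have d : cls S chi t `&` (S `&` [set x | chi x \in s]) = set0.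
  by apply: setI0_intro => x [_ /= ->] [_ /=]; rewrite (negPf ts).
split; first exact: kpieceU.
by move=> f hf; rewrite (kvalU hf (h t) ds d) fs // big_cons.
Qed.

Lemma part_total K (T : finType) S (chi : R -> T) : part K S chi ->
  kpiece K S /\ forall f, valuation f -> f S = \sum_t f (cls S chi t).
Proof.
move=> h; have [dS fS] := part_seq (index_enum_uniq T) h.
have e : S `&` [set x | chi x \in index_enum T] = S.
  by apply/setIidPl => x _ /=; rewrite mem_index_enum.
by rewrite e in dS fS.
Qed.

Lemma part_comp K (T : finType) (T' : eqType) S (chi : R -> T) (h : T ->
  T') : part K S chi ->
  part K S (h \o chi) /\
  forall f, valuation f -> forall t, f (cls S (h \o chi) t) = \sum_(u |
    h u == t) f (cls S chi u).
Proof.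
move=> pc.
have e t : cls S (h \o chi) t = S `&` [set x | chi x \in [seq u <- index_enum T |
  h u == t]].
  by apply/seteqP; split=> x [Sx /= hx]; split=> //=; move: hx;
    rewrite mem_filter mem_index_enum andbT => /eqP.
have u t : uniq ([seq u <- index_enum T | h u == t])
  by rewrite filter_uniq // index_enum_uniq.
split=> [t|f hf t]; rewrite e; have [d v] := part_seq (u t) pc => //.
by rewrite v // big_filter.
Qed.

(** One share is cut off at the right end. With [k] the size of [s], color [t] receives what lies
    beyond the point where the fraction [k / (k + 1)] is reached, and the other [k] colors divide
    the rest. *)
Lemma reach_equal K A v (T : eqType) (s : seq T) : K `<=` profiles -> kpiece K A ->
  s != [::] -> uniq s ->
  reach (fun K' => exists chi : R -> T, [/\ forall x, chi x \in s, part K' A chi &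
    forall f, K' f -> forall t, t \in s -> f v (cls A chi t) = f v A / (size s)%:R])
    (size s * #|V|.+1) K.
Proof.
elim: s K A => [|t s IH] K A KV dA // _ /andP[ts us].
have [s0|s0] := eqVneq s [::].
  apply: reach_done => _; exists (fun=> t); rewrite s0 /=.
  have e : cls A (fun=> t) t = A by apply/setIidPl.
  split=> [x|u|f Kf u]; first exact: mem_head.
    have [->|tu] := eqVneq u t; first by rewrite e.
    suff -> : cls A (fun=> t) u = set0 by exact: kpiece0.
    by apply: setI0_intro => x _ /= ut; rewrite ut eqxx in tu.
  by rewrite inE => /eqP ->; rewrite e divr1.
have sz : (0 < size s)%N by case: (s) s0.
have k0 : 0 < (size s)%:R :> R by rewrite ltr0n.
have k1 : (size (t :: s))%:R = (size s)%:R + 1 :> R by rewrite /= -natr1.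
rewrite mulSn; apply: reach_nonempty => -[f0 Kf0].
have det f g A' : K f -> K g -> kpiece K A' -> f v A' = g v A' by move=> Kf Kg dA';
  exact: (kpiece_det v KV dA' Kf Kg).
apply: (reach_bind (G' := fun K' => exists p, [/\ known K' p, 0 <= p <= 1 &
    forall f, K' f -> f v (pre A p) = (size s)%:R / (size (t :: s))%:R * f v A])).
  apply: (reach_weaken (@reach_pre _ _ K A v 0 1 ((size s)%:R / (size (t :: s))%:R * f0 v A) KV dA (known0 KV) (known1 KV) ler01 _)) => //.
    move=> f Kf; have hf := KV _ Kf v.
    have h0 : 0 <= f v A by exact: (kval_ge0 hf dA).
    have r01 : 0 <= ((size s)%:R / (size (t :: s))%:R : R) <= 1.
      by rewrite k1 divr_ge0 ?ler_pdivrMr /=; lra.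
    rewrite (pre0 hf dA) (pre1 dA) (det f0 f) // ?Kf0 //; apply/andP; split;
      first by apply: mulr_ge0; lra.
    by rewrite ler_piMl; lra.
  move=> K' sub _ [p [kp p01 h]]; exists p; split=> // f K'f.
  by rewrite h // (det f0 f) // ?Kf0 //; exact: sub.
move=> K' sub K'0 [p [kp p01 hp]].
have K'V : K' `<=` profiles by move=> f /sub /KV.
have dA' := kpiece_sub sub dA.
have dpre := kpiece_pre kp dA'; have dpost := kpiece_post kp dA'.
apply: (reach_weaken (IH K' (pre A p) K'V dpre s0 us)) => // K2 sub2 _ [chi [cs pc hc]].
pose chi' x := if x <= p then chi x else t.
have e1 u : u != t -> cls A chi' u = cls (pre A p) chi u.
  move=> ut; apply/seteqP; split=> x.
    by move=> [Ax /=]; rewrite /chi'; case: ifP => [xp <-|_ e]; [|rewrite e eqxx in ut].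
  by move=> [[Ax /= xp] /= <-]; split=> //=; rewrite /chi' xp.
have e2 : cls A chi' t = post A p.
  apply/seteqP; split=> x.
    move=> [Ax /=]; rewrite /chi'; case: (leP x p) => [xp e|xp _]; last by split.
    by have := cs x; rewrite e (negPf ts).
  by move=> [Ax /= xp]; split=> //=; rewrite /chi' leNgt xp.
exists chi'; split=> [x|u|f K2f u].
- by rewrite /chi' inE; case: ifP; rewrite ?cs ?eqxx ?orbT.
- have [->|ut] := eqVneq u t; first by rewrite e2; exact: kpiece_sub sub2 _.
  by rewrite e1 //; exact: pc.
- have K'f := sub2 _ K2f; have hf := K'V _ K'f v.
  have tot := kval_pre_post hf dA' p01; have hpf := hp _ K'f.
  rewrite k1 in hpf *.
  have sz1 : (size s)%:R + 1 != 0 :> R by rewrite natr1 pnatr_eq0.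
  have sz0 : (size s)%:R != 0 :> R by rewrite pnatr_eq0 -lt0n.
  have [->|ut] := eqVneq u t.
    move=> _; rewrite e2; have -> : f v (post A p) = f v A - f v (pre A p) by lra.
    by rewrite hpf; field.
  by rewrite inE (negPf ut) /= => us'; rewrite e1 // hc // hpf; field; rewrite sz1 sz0.
Qed.

End Colorings.

(** * Trimming contested pieces *)

Section Trimming.
Local Open Scope classical_set_scope.
Local Open Scope ring_scope.

Variables (R : realType) (V J : finType) (P : J -> set R).
Local Notation prof := (V -> set R -> R).
Local Notation profiles := (profiles (R:=R) (V:=V)).
Implicit Types (K : set prof) (p : R) (Y X W T : {set V}) (M : {set J}).
Implicit Types (sg om : V -> J) (b c d e : J -> R).

Definition tval (f : prof) v j p := f v (pre (P j) p).

Definition known_pieces K := forall j, kpiece K (P j).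

Lemma tval_det K f g v j p : K `<=` profiles -> known_pieces K -> known K p -> K f -> K g ->
  tval f v j p = tval g v j p.
Proof. by move=> KV dP kp Kf Kg; apply: (kpiece_det v KV _ Kf Kg); exact: kpiece_pre. Qed.

Lemma tval_le K f v j p p' : K `<=` profiles -> known_pieces K -> K f -> known K p ->
  known K p' -> p <= p' ->
  tval f v j p <= tval f v j p'.
Proof.
move=> KV dP Kf [/andP[p0 _] _] [/andP[_ p1] _] pp'.
exact: (pre_le (KV _ Kf v) (dP j)).
Qed.

(* [c j] is the point at which piece [j] is cut off. *)
Record eftrim K Y M sg c : Prop := EfTrim {
  eftrim_in : forall v, v \in Y -> sg v \in M;
  eftrim_inj : {in Y &, injective sg};
  eftrim_known : forall j, j \in M -> known K (c j);
  eftrim_ef : forall f, K f -> forall v j, v \in Y -> j \in M ->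
    tval f v j (c j) <= tval f v (sg v) (c (sg v)) }.

Lemma eftrim_sub K K' Y M sg c : K' `<=` K -> eftrim K Y M sg c -> eftrim K' Y M sg c.
Proof.
move=> sub [h1 h2 h3 h4]; split=> // [j jM|f /sub]; last exact: h4.
by apply: known_sub sub _; exact: h3.
Qed.

(** The last clause pays off whenever there are more pieces than agents, since some piece then
    remains at its full level [b]. Such pieces are the outside options in [trimmableS], the piece
    [j0] in [reach_contest] and the share of the cutter in [reach_core]. *)
Definition trimmed K Y M b d :=
  exists sg c, [/\ eftrim K Y M sg c, forall j, j \in M -> d j <= c j <= b j &
    forall j, j \in M -> (forall v, v \in Y -> sg v <> j) -> c j = b j].

Definition trim_cost := (#|V| * #|J| * #|V|.+1)%N.

(* The envy-free assignment [(tau, d)] is a floor: pieces never shrink below it, so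
   that utilities only grow from one recursive call to the next.  No optimality of the
   outcome is claimed; it would fail where some agents have zero density. *)
Definition trimmable m := forall K Y M b tau d, #|Y| = m -> K `<=` profiles ->
  known_pieces K ->
  (forall j, j \in M -> known K (b j) /\ d j <= b j) -> eftrim K Y M tau d ->
  reach (fun K' => trimmed K' Y M b d) (trim_cost * 3 ^ m) K.

(** Here [be v] is what [v] can get elsewhere. She trims each piece down to that value, or leaves it
    at [c j] when it is not worth more; the hypothesis on [d] says that the floor does not exceed
    that value. *)
Lemma reach_trims K (Z : {set V}) M c d (be : V -> R) : K `<=` profiles -> known_pieces K ->
  (forall j, j \in M -> [/\ known K (c j), known K (d j) & d j <= c j]) ->
  (forall f, K f -> forall v j, v \in Z -> j \in M -> tval f v j (d j) <= be v) ->
  reach (fun K' => exists t : V -> J -> R, forall v j, v \in Z -> j \in M ->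
    [/\ known K' (t v j), d j <= t v j <= c j &
     forall f, K' f -> tval f v j (t v j) <= be v /\
       (t v j = c j \/ tval f v j (t v j) = be v)]) trim_cost K.
Proof.
move=> KV dP kcd hd.
suff h (s : seq (V * J)) : reach (fun K' => exists t : V -> J -> R, forall v j,
    (v, j) \in s -> v \in Z -> j \in M ->
    [/\ known K' (t v j), d j <= t v j <= c j &
     forall f, K' f -> tval f v j (t v j) <= be v /\
       (t v j = c j \/ tval f v j (t v j) = be v)]) (size s * #|V|.+1) K.
  apply: (reach_weaken (h (enum {: V * J}))); first by rewrite -cardE card_prod.
  by move=> K' _ _ [t ht]; exists t => v j; apply: ht; rewrite mem_enum.
elim: s => [|[v j] s IH]; first by apply: reach_done => _; exists (fun _ j => c j).
rewrite /= mulSn addnC; apply: (reach_bind IH) => K' sub [f0 K'f0] [t ht].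
have K'V : K' `<=` profiles by move=> f /sub /KV.
have dP' : known_pieces K' by move=> i; exact: kpiece_sub sub (dP i).
have [vZ|vZ] := boolP (v \in Z); last first.
  apply: reach_done => _; exists t => v' j'; rewrite inE => /orP[/eqP[-> _] /(negP vZ)//|];
    exact: ht.
have [jM|jM] := boolP (j \in M); last first.
  apply: reach_done => _; exists t => v' j';
    rewrite inE => /orP[/eqP[_ ->] _ /(negP jM)//|]; exact: ht.
have [kc kd dc] := kcd _ jM.
have kc' := known_sub sub kc; have kd' := known_sub sub kd.
have ext K2 (x : R) : K2 `<=` K' -> known K2 x -> d j <= x <= c j ->
    (forall f, K2 f -> tval f v j x <= be v /\ (x = c j \/ tval f v j x = be v)) ->
    exists t : V -> J -> R, forall v0 j0,
    (v0, j0) \in (v, j) :: s -> v0 \in Z -> j0 \in M ->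
    [/\ known K2 (t v0 j0), d j0 <= t v0 j0 <= c j0 &
     forall f, K2 f -> tval f v0 j0 (t v0 j0) <= be v0 /\
       (t v0 j0 = c j0 \/ tval f v0 j0 (t v0 j0) = be v0)].
  move=> sub2 kx dxc hx; exists (fun v0 j0 => if (v0, j0) == (v,
    j) then x else t v0 j0) => v0 j0.
  rewrite inE; case: eqP => [[-> ->] //|_ /= vs v0Z j0M].
  have [h1 h2 h3] := ht _ _ vs v0Z j0M; split=> //; first exact: known_sub sub2 h1.
  by move=> f /sub2; exact: h3.
have [le|gt] := leP (tval f0 v j (c j)) (be v).
  apply: reach_done => _; apply: (ext K' (c j)) => //; first by rewrite dc lexx.
  by move=> f K'f; split; [rewrite (tval_det v j K'V dP' kc' K'f K'f0)|left].
apply: (reach_weaken (@reach_pre _ _ K' (P j) v (d j) (c j) (be v) K'V (dP' j) kd' kc' dc _)) => //.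
  move=> f K'f; apply/andP; split; first by apply: hd => //; exact: sub.
  by rewrite -/(tval f v j (c j)) (tval_det v j K'V dP' kc' K'f K'f0) ltW.
move=> K2 sub2 _ [x [kx dxc hx]]; apply: (ext K2 x) => // f K2f.
by rewrite /tval hx //; split=> //; right.
Qed.

Lemma bigmin_cases (L : {set V}) (x : R) (t : V -> R) :
  \big[Num.min/x]_(v in L) t v = x \/
  exists2 v, v \in L & \big[Num.min/x]_(v in L) t v = t v.
Proof.
elim/big_ind: _ => [|u w hu hw|v vL]; [by left| |by right; exists v].
by case: (leP u w).
Qed.

Lemma trimmable0 : trimmable 0.
Proof.
move=> K Y M b tau d /eqP; rewrite cards_eq0 => /eqP -> KV dP kb ef.
apply: reach_done => _; exists tau, b; split=> //; last by move=> j /kb[_ ->]; rewrite lexx.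
by split=> [v|v w|j /kb[]|f _ v j]; rewrite ?inE.
Qed.

(** * ** Adding one agent: the contest for the sold pieces *)

Section Step.
Variables (X : {set V}) (a : V) (M : {set J}) (sg : V -> J) (c d : J -> R).
Variables (be : V -> R) (Z : {set V}) (t : V -> J -> R) (K0 : set prof).
Let Y := (a |: X)%SET.
Hypothesis K0V : K0 `<=` profiles.
Hypothesis dP0 : known_pieces K0.
Hypothesis ME : M = [set sg v | v in X]%SET.
Hypothesis sgc : eftrim K0 X M sg c.
Hypothesis sgbe : forall f, K0 f -> forall v, v \in X -> be v <= tval f v (sg v) (c (sg v)).
Hypothesis ht : forall v j, v \in Z -> j \in M ->
    [/\ known K0 (t v j), d j <= t v j <= c j &
     forall f, K0 f -> tval f v j (t v j) <= be v /\
       (t v j = c j \/ tval f v j (t v j) = be v)].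
Hypothesis IH : forall m, (m <= #|X|)%N -> trimmable m.

Definition contested T : {set J} := (M :\: [set sg v | v in T])%SET.
Definition losers T W : {set V} := (Y :\: (W :|: T))%SET.
(** A level below the trims of all agents of [L]: none of them prefers piece [j], cut there, to her
    outside option. *)
Definition upper (L : {set V}) j := \big[Num.min/c j]_(x in L) t x j.

(* [T] keeps its pieces at level [c] for good, [W] is the current set of winners
   of the contested pieces, and the losers would accept their outside option. *)
Record contest K T W om e : Prop := Contest {
  contest_TX : T \subset X;
  contest_WY : W \subset Y;
  contest_WT : forall v, v \in W -> v \notin T;
  contest_LZ : losers T W \subset Z;
  contest_efm : eftrim K W (contested T) om e;
  contest_e : forall j, j \in contested T -> d j <= e j <= upper (losers T W) j;
  contest_be : forall f, K f -> forall v, v \in W -> be v <= tval f v (om v) (e (om v));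
  contest_W : forall f, K f -> forall v w, v \in W -> w \in T ->
    tval f v (sg w) (c (sg w)) <= tval f v (om v) (e (om v));
  contest_L : forall f, K f -> forall x w, x \in losers T W -> w \in T ->
    tval f x (sg w) (c (sg w)) <= be x }.

Lemma contestedM T j : j \in contested T -> j \in M.
Proof. by rewrite inE => /andP[]. Qed.

Lemma card_contested T : T \subset X -> (#|contested T| + #|T| = #|X|)%N.
Proof.
move=> TX; have inj : {in X &, injective sg} := eftrim_inj sgc.
have injT : {in T &, injective sg} by move=> v w vT wT; apply: inj;
  exact: (fintype.subsetP TX).
rewrite -(card_in_imset inj) -(card_in_imset injT) -ME /contested.
rewrite cardsD (finset.setIidPr _) ?subnK //; last by rewrite ME imsetS.
by apply: subset_leq_card; rewrite ME imsetS.
Qed.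

Lemma upper_known T W j : losers T W \subset Z -> j \in M ->
  known K0 (upper (losers T W) j).
Proof.
move=> LZ jM; rewrite /upper; apply: big_ind => [|x y|v vL];
  [exact: eftrim_known sgc _ jM|exact: known_min|].
by have [] := ht (fintype.subsetP LZ _ vL) jM.
Qed.

Lemma card_W K T W om e : contest K T W om e -> (#|W| <= #|contested T|)%N.
Proof.
move=> h; rewrite -(card_in_imset (eftrim_inj (contest_efm h))); apply: subset_leq_card.
by apply/fintype.subsetP => _ /imsetP[v vW ->]; exact: eftrim_in (contest_efm h) _ vW.
Qed.

Lemma upper_le L j : upper L j <= c j.
Proof. exact: bigmin_le_id. Qed.

(* Some contested piece [j0] stays unsold, hence is as large as the losers allow.
   Either a loser accepts it and becomes a winner, or it has size [c j0] and its
   previous owner, who must be a winner, takes it back for good. *)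
Lemma reach_contest K T W om e : K `<=` K0 -> contest K T W om e ->
  reach (fun K' => exists T W om e, contest K' T W om e /\ #|W| = #|contested T|)
    (trim_cost * (3 ^ #|contested T| - 3 ^ #|W|)) K.
Proof.
(* Both outcomes of a step lower this measure by one: either [W] gains an agent, or [W] and the
   contested pieces both lose one. *)
have [n] := ubnP (2 * #|contested T| - #|W|); elim: n K T W om e => // n IHn K T W om e.
rewrite ltnS => hn sub h; have WM := card_W h.
have [eqWM|neWM] := eqVneq #|W| #|contested T|.
  by apply: reach_done => _; exists T, W, om, e.
have ltWM : (#|W| < #|contested T|)%N by rewrite ltn_neqAle neWM.
have KV : K `<=` profiles by move=> f /sub /K0V.
have dP : known_pieces K by move=> j; exact: kpiece_sub sub (dP0 j).
have TX := contest_TX h; have cT := card_contested TX.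
set L := losers T W in h *.
have LZ : L \subset Z := contest_LZ h.
have WX : (#|W| <= #|X|)%N by lia.
have top := IH WX (K := K) (M := contested T) (b := upper L) erefl KV dP _ (contest_efm h).
have p3 : (0 < 3 ^ #|W|)%N by rewrite expn_gt0.
have p3' : (3 ^ #|W|.+1 <= 3 ^ #|contested T|)%N by rewrite leq_exp2l.
rewrite expnS in p3'.
(* What remains of the potential once the recursive call for [W] has been paid with [3 ^ #|W|]. The
   base is dictated by the outcome in which both exponents drop by one: with gap one it asks for
   [b ^ 2 - 3 * b + 1 >= 0], and [3] is the least such integer above [1]. *)
pose rest := (3 ^ #|contested T| - 3 * 3 ^ #|W| + 3 ^ #|W|)%N.
have -> : (trim_cost * (3 ^ #|contested T| - 3 ^ #|W|) = trim_cost * 3 ^ #|W|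
  + trim_cost * rest)%N.
  by rewrite -mulnDr /rest; congr (_ * _)%N; lia.
apply: (reach_bind (top _)).
  move=> j jM; split; last by have /andP[h1 h2] := contest_e h jM.
  by apply: known_sub sub _; apply: upper_known => //; exact: contestedM jM.
move=> K' sub' [f0 K'f0] [om' [e' [ef' ee' full]]].
have subK0 : K' `<=` K0 by move=> f /sub' /sub.
have K'V : K' `<=` profiles by move=> f /sub' /KV.
have dP' : known_pieces K' by move=> j; exact: kpiece_sub sub' (dP j).
have [j0 j0M j0W] : exists2 j0, j0 \in contested T & forall v, v \in W -> om' v <> j0.
  have /fintype.subsetPn[j jM jW] : ~~ (contested T \subset [set om' v | v in W]%SET).
    apply/negP => /subset_leq_card; rewrite leqNgt => /negP; apply.
    exact: leq_ltn_trans (leq_imset_card _ _) ltWM.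
  by exists j => // v vW e1; case/negP: jW; apply/imsetP; exists v.
have e'0 := full _ j0M j0W.
have j0M' := contestedM j0M.
have kup j : j \in contested T -> known K' (upper L j).
  by move=> jT; apply: known_sub subK0 _; apply: upper_known => //; exact: contestedM jT.
have kt x j : x \in L -> j \in contested T -> known K' (t x j).
  move=> xL jT; have [kx _ _] := ht (fintype.subsetP LZ _ xL) (contestedM jT);
    exact: known_sub subK0 kx.
have kc j : j \in M -> known K' (c j) by move=> jM; apply: known_sub subK0 _;
  exact: eftrim_known sgc _ jM.
have dle j : j \in contested T -> d j <= e' j.
  by move=> jT; have /andP[h1 _] := contest_e h jT; have /andP[h2 _] := ee' _ jT;
    exact: le_trans h1 h2.
have upx x j : x \in L -> upper L j <= t x j by move=> xL; exact: bigmin_le_cond.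
have Fup f x j : K' f -> x \in L -> j \in contested T -> tval f x j (e' j) <= be x.
  move=> K'f xL jT; have [_ _ /(_ f (subK0 _ K'f))[tb _]] :=
    ht (fintype.subsetP LZ _ xL) (contestedM jT).
  apply: le_trans tb; apply: (tval_le _ _ K'V dP') => //;
    [exact: eftrim_known ef' _ jT|exact: kt|].
  by have /andP[_ h2] := ee' _ jT; apply: le_trans h2 (upx _ _ xL).
have omM : forall v, v \in W -> om v \in contested T := eftrim_in (contest_efm h).
have Fom f v : K' f -> v \in W ->
  tval f v (om v) (e (om v)) <= tval f v (om' v) (e' (om' v)).
  move=> K'f vW; apply: le_trans (eftrim_ef ef' K'f vW (omM _ vW)).
  apply: (tval_le _ _ K'V dP' K'f);
    [|exact: eftrim_known ef' _ (omM _ vW)|by case/andP: (ee' _ (omM _ vW))].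
  by apply: known_sub sub' _; exact: eftrim_known (contest_efm h) _ (omM _ vW).
have be' f v : K' f -> v \in W -> be v <= tval f v (om' v) (e' (om' v)).
  by move=> K'f vW; apply: le_trans (Fom _ _ K'f vW); apply: contest_be h _ _ _ vW;
    exact: sub'.
have W' f v w : K' f -> v \in W -> w \in T ->
  tval f v (sg w) (c (sg w)) <= tval f v (om' v) (e' (om' v)).
  by move=> K'f vW wT; apply: le_trans (Fom _ _ K'f vW); apply: contest_W h _ _ _ _ vW wT;
    exact: sub'.
have [[x xL hx]|noint] := pselect (exists2 x, x \in L & be x <= tval f0 x j0 (upper L j0)).
- have hx' f : K' f -> tval f x j0 (e' j0) = be x.
    move=> K'f; apply/eqP; rewrite eq_le Fup //= e'0 (tval_det x j0 K'V dP' _ K'f K'f0) //;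
      exact: kup.
  have [xY xWT] : x \in Y /\ x \notin (W :|: T)%SET by move: xL; rewrite inE => /andP[].
  have [xW xT] : x \notin W /\ x \notin T by move: xWT; rewrite inE negb_or => /andP[].
  pose om2 v := if v == x then j0 else om' v.
  have om2W v : v \in W -> om2 v = om' v by move=> vW; rewrite /om2; case: eqP => // vx;
    rewrite -vx vW in xW.
  have om2x : om2 x = j0 by rewrite /om2 eqxx.
  have LE y : y \in losers T (x |: W)%SET -> y \in L.
    by rewrite !inE !negb_or => /andP[/andP[/andP[_ ->] ->] ->].
  have upLE j : upper L j <= upper (losers T (x |: W)%SET) j.
    apply/bigmin_geP; split; first exact: upper_le.
    by move=> y /LE yL; exact: upx.
  have h2 : contest K' T (x |: W)%SET om2 e'.
    split=> //.
    + by apply/fintype.subsetP => v; rewrite finset.in_setU1 => /orP[/eqP ->//|];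
        exact: (fintype.subsetP (contest_WY h)).
    + by move=> v; rewrite finset.in_setU1 => /orP[/eqP ->//|]; exact: (contest_WT h).
    + by apply/fintype.subsetP => y /LE; exact: (fintype.subsetP LZ).
    + split.
      * move=> v; rewrite finset.in_setU1 => /orP[/eqP ->|vW]; first by rewrite om2x.
        by rewrite om2W //; exact: eftrim_in ef' _ vW.
      * move=> v w; rewrite !finset.in_setU1 => /orP[/eqP ->|vW] /orP[/eqP ->|wW] //.
        - by rewrite om2x om2W // => e1; case: (j0W _ wW).
        - by rewrite om2x om2W // => e1; case: (j0W _ vW).
        - by rewrite !om2W //; exact: eftrim_inj ef' _ _ vW wW.
      * exact: eftrim_known ef'.
      * move=> f K'f v j; rewrite finset.in_setU1 => /orP[/eqP ->|vW] jT.
          by rewrite om2x hx' //; exact: Fup.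
        by rewrite om2W //; exact: eftrim_ef ef' _ K'f _ _ vW jT.
    + move=> j jT; rewrite dle //=; have /andP[_ h1] := ee' _ jT;
        exact: le_trans h1 (upLE j).
    + by move=> f K'f v; rewrite finset.in_setU1 => /orP[/eqP ->|vW];
        rewrite ?om2x ?hx' // om2W //; exact: be'.
    + move=> f K'f v w; rewrite finset.in_setU1 => /orP[/eqP ->|vW] wT;
        last by rewrite om2W //; exact: W'.
      by rewrite om2x hx' //; apply: (contest_L h _ xL wT); exact: sub'.
    + by move=> f K'f y w /LE yL wT; apply: (contest_L h _ yL wT); exact: sub'.
  have cW : #|(x |: W)%SET| = #|W|.+1 by rewrite cardsU1 xW.
  apply: (reach_weaken (IHn K' T _ om2 e' _ subK0 h2)) => //; first by rewrite cW; lia.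
  by rewrite cW expnS leq_mul2l /rest; apply/orP; right; lia.
- have no x : x \in L -> tval f0 x j0 (upper L j0) < be x.
    by move=> xL; rewrite ltNge; apply/negP => hx; apply: noint; exists x.
  (* If the minimum were the trim of some loser and less than [c j0], that loser would be exactly
     indifferent there and would accept [j0]. *)
  have upc : upper L j0 = c j0.
    have [//|[x xL ex]] := bigmin_cases L (c j0) (fun x => t x j0).
    have [_ _ /(_ _ (subK0 _ K'f0))[_ [|eb]]] := ht (fintype.subsetP LZ _ xL) j0M';
      first by rewrite /upper ex.
    by have := no _ xL; rewrite /upper ex eb ltxx.
  have [y0 y0X j0E] : exists2 y0, y0 \in X & j0 = sg y0 by move: j0M';
    rewrite ME => /imsetP[y yX ->]; exists y.
  have y0T : y0 \notin T.
    by apply/negP => yT; move: j0M; rewrite inE => /andP[/negP[]]; rewrite j0E imset_f.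
  (* By [sgbe] the former owner values [j0] at level [c] at least as much as her outside option, so
     she would have accepted it as a loser. *)
  have y0L : y0 \notin L.
    apply/negP => yL; have := no _ yL; rewrite upc ltNge => /negP; apply.
    by rewrite j0E; apply: sgbe => //; exact: subK0.
  have y0W : y0 \in W.
    move: y0L; rewrite !inE (negPf y0T) y0X orbT orbF andbT negbK //.
  pose T2 := (y0 |: T)%SET; pose W2 := (W :\ y0)%SET.
  have LE : losers T2 W2 = L.
    apply/setP => y; rewrite !inE; case: (eqVneq y y0) => [->|] /=; last by [].
    by rewrite y0W.
  have cE j : j \in contested T2 -> j \in contested T /\ j <> j0.
    rewrite !inE => /andP[jT2 jM]; split.
      by rewrite jM andbT; apply: contra jT2 => /imsetP[v vT ->];
        rewrite imset_f // inE vT orbT.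
    by move=> jj; case/negP: jT2; rewrite jj j0E imset_f ?finset.setU11.
  have W2W v : v \in W2 -> v \in W by rewrite inE => /andP[].
  have om'2 v : v \in W2 -> om' v \in contested T2.
    move=> vW2; have vW := W2W _ vW2; have := eftrim_in ef' vW;
      rewrite !inE => /andP[nT ->]; rewrite andbT.
    apply/negP => /imsetP[w]; rewrite finset.in_setU1 => /orP[/eqP -> e1|wT e1];
      first by apply: (j0W _ vW); rewrite j0E.
    by case/negP: nT; rewrite e1 imset_f.
  have h2 : contest K' T2 W2 om' e'.
    split.
    + by apply/fintype.subsetP => v; rewrite finset.in_setU1 => /orP[/eqP ->//|];
        exact: (fintype.subsetP TX).
    + by apply/fintype.subsetP => v /W2W; exact: (fintype.subsetP (contest_WY h)).
    + move=> v; rewrite !inE => /andP[vy vW].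
      by rewrite (negPf vy) (contest_WT h vW).
    + by rewrite LE.
    + split=> //.
      * by move=> v w /W2W vW /W2W wW; exact: eftrim_inj ef' _ _ vW wW.
      * by move=> j /cE[jT _]; exact: eftrim_known ef' _ jT.
      * by move=> f K'f v j /W2W vW /cE[jT _]; exact: eftrim_ef ef' _ K'f _ _ vW jT.
    + by move=> j /cE[jT _]; rewrite LE dle //=; case/andP: (ee' _ jT).
    + by move=> f K'f v /W2W; exact: be'.
    + move=> f K'f v w /W2W vW; rewrite finset.in_setU1 => /orP[/eqP ->|]; last exact: W'.
      by rewrite -j0E -upc -e'0; exact: eftrim_ef ef' _ K'f _ _ vW j0M.
    + move=> f K'f x w; rewrite LE finset.in_setU1 => xL /orP[/eqP ->|wT].
        by rewrite -j0E -upc -e'0; exact: Fup.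
      by apply: (contest_L h _ xL wT); exact: sub'.
  have cW : #|W| = #|W2|.+1 by rewrite (cardsD1 y0) y0W.
  have cT2 : #|T2| = #|T|.+1 by rewrite cardsU1 y0T.
  have T2X : T2 \subset X := contest_TX h2.
  have cC := card_contested T2X.
  have cC' : #|contested T| = #|contested T2|.+1 by lia.
  apply: (reach_weaken (IHn K' T2 W2 om' e' _ subK0 h2)) => //; first by lia.
  rewrite leq_mul2l; apply/orP; right; move: p3' p3; rewrite /rest cW cC' !expnS; lia.
Qed.

End Step.

Lemma eftrim_restrict K Y X M M' sg c : X \subset Y -> M' \subset M ->
  (forall v, v \in X -> sg v \in M') -> eftrim K Y M sg c -> eftrim K X M' sg c.
Proof.
move=> /fintype.subsetP XY /fintype.subsetP MM' h [h1 h2 h3 h4]; split=> //.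
- by move=> v w /XY vY /XY wY; exact: h2.
- by move=> j /MM'; exact: h3.
- by move=> f Kf v j /XY vY /MM' jM; exact: h4.
Qed.

(** All agents but [a] are served first. The pieces left unsold are uncut and offer everybody an
    outside option; the sold ones, now too few by one, are contested. In the end a single loser
    remains, and she takes her best outside option. *)
Lemma trimmableS m : (forall k, (k <= m)%N -> trimmable k) -> trimmable m.+1.
Proof.
move=> IH K Y M0 b tau d cY KV dP kb ef.
have [a aY] : exists a, a \in Y by apply/card_gt0P; rewrite cY.
pose X := (Y :\ a)%SET; have aX : a \notin X by rewrite !inE eqxx.
have YE : Y = (a |: X)%SET by rewrite finset.setD1K.
have cX : #|X| = m by have := cardsD1 a Y; rewrite aY cY /X => -[].
have XY : X \subset Y by rewrite YE finset.subsetUr.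
have efX : eftrim K X M0 tau d.
  by apply: (eftrim_restrict XY _ _ ef) => // v vX; apply: (eftrim_in ef);
    exact: (fintype.subsetP XY).
have cost : (trim_cost * 3 ^ m + (trim_cost + trim_cost * (3 ^ m - 1)) <=
  trim_cost * 3 ^ m.+1)%N.
  have : (0 < 3 ^ m)%N by rewrite expn_gt0.
  by rewrite expnS; case: (3 ^ m)%N => // k _; rewrite subn1 /=; nia.
apply: (reach_le cost); apply: (reach_bind (IH m (leqnn m) K X M0 b tau d cX KV dP kb efX)).
move=> K1 sub1 [f1 K1f1] [sg [c [sgc0 dcb full]]].
have K1V : K1 `<=` profiles by move=> f /sub1 /KV.
have dP1 : known_pieces K1 by move=> j; exact: kpiece_sub sub1 (dP j).
pose M := [set sg v | v in X]%SET; pose U := (M0 :\: M)%SET.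
have MM0 j : j \in M -> j \in M0 by case/imsetP => v vX ->; exact: eftrim_in sgc0 _ vX.
have sgc : eftrim K1 X M sg c.
  apply: (eftrim_restrict _ _ _ sgc0) => //; first exact/fintype.subsetP.
  by move=> v vX; exact: imset_f.
have [u0 u0U] : exists u0, u0 \in U.
  have cM : #|M| = m by rewrite (card_in_imset (eftrim_inj sgc)).
  have : (#|Y| <= #|M0|)%N.
    rewrite -(card_in_imset (eftrim_inj ef)); apply: subset_leq_card.
    by apply/fintype.subsetP => _ /imsetP[v vY ->]; exact: eftrim_in ef _ vY.
  rewrite cY => le; apply/card_gt0P; rewrite cardsD subn_gt0; apply: leq_trans le.
  by rewrite ltnS -cM subset_leq_card // finset.subsetIr.
have UM0 j : j \in U -> j \in M0 by rewrite inE => /andP[].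
have kc : forall j, j \in M0 -> known K1 (c j) := eftrim_known sgc0.
pose best v := [arg max_(j > u0 in U) tval f1 v j (c j)]%O.
pose be v := tval f1 v (best v) (c (best v)).
have bestP v : best v \in U /\ forall f j, K1 f -> j \in U -> tval f v j (c j) <= be v.
  rewrite /be /best; case: arg_maxP => // j jU jmax; split=> // f i K1f iU.
  by rewrite (tval_det v i K1V dP1 (kc _ (UM0 _ iU)) K1f K1f1); exact: jmax.
have beE f v : K1 f -> tval f v (best v) (c (best v)) = be v.
  by move=> K1f; apply: (tval_det v _ K1V dP1 _ K1f K1f1); apply: kc; apply: UM0;
    case: (bestP v).
(* Agents who would lose by exchanging their floor piece for an outside option start as winners with
   that floor piece, which must then lie in [M]. For the others no piece at floor level is worth
   more than [be], so they can trim down to [be]. *)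
pose W0 := [set v in Y | be v < tval f1 v (tau v) (d (tau v))]%SET;
  pose Z := (Y :\: W0)%SET.
have kd j : j \in M0 -> known K1 (d j) by move=> jM; apply: known_sub sub1 _;
  exact: eftrim_known ef _ jM.
have efd f v j : K1 f -> v \in Y -> j \in M0 ->
  tval f v j (d j) <= tval f v (tau v) (d (tau v)).
  by move=> K1f vY jM; apply: eftrim_ef ef _ _ _ _ vY jM; exact: sub1.
have tauM v : v \in Y -> tau v \in M0 := @eftrim_in _ _ _ _ _ ef v.
apply: (reach_bind (@reach_trims K1 Z M c d be K1V dP1 _ _)).
- move=> j /MM0 jM; split; [exact: kc|exact: kd|by case/andP: (dcb _ jM)].
- move=> f K1f v j; rewrite !inE => /andP[+ vY] /MM0 jM; rewrite vY /= -leNgt => le.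
  apply: le_trans le; rewrite -(tval_det v (tau v) K1V dP1 (kd _ (tauM _ vY)) K1f K1f1);
    exact: efd.
move=> K2 sub2 [f2 K2f2] [t ht].
have K2V : K2 `<=` profiles by move=> f /sub2 /K1V.
have dP2 : known_pieces K2 by move=> j; exact: kpiece_sub sub2 (dP1 j).
have sgbe f : K2 f -> forall v, v \in X -> be v <= tval f v (sg v) (c (sg v)).
  move=> K2f v vX; have K1f := sub2 _ K2f; rewrite -(beE f v K1f).
  by apply: eftrim_ef sgc0 _ K1f _ _ vX _; apply: UM0; case: (bestP v).
have IHX k : (k <= #|X|)%N -> trimmable k by rewrite cX; exact: IH.
have ini : contest X a M sg c d be Z t K2 finset.set0 W0 tau d.
  have W0Y v : v \in W0 -> v \in Y by rewrite inE => /andP[].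
  have cT : contested M sg finset.set0 = M by rewrite /contested imset0 finset.setD0.
  have LE : losers X a finset.set0 W0 = Z by rewrite /losers finset.setU0 -YE.
  have tauW v : v \in W0 -> tau v \in M.
    rewrite inE => /andP[vY]; rewrite ltNge; apply: contraR => tM.
    have tU : tau v \in U by rewrite inE tM tauM.
    have [_ /(_ _ _ K1f1 tU)] := bestP v; apply: le_trans.
    by apply: (tval_le _ _ K1V dP1 K1f1);
      [exact/kd/tauM|exact/kc/tauM|case/andP: (dcb _ (tauM _ vY))].
  split; rewrite ?LE ?cT //.
  - by apply/fintype.subsetP => v; rewrite inE.
  - by rewrite -YE; apply/fintype.subsetP.
  - by move=> v _; rewrite inE.
  - apply: (eftrim_sub sub2); apply: (eftrim_sub sub1);
      apply: (eftrim_restrict _ _ _ ef) => //; exact/fintype.subsetP.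
  - move=> j jM; rewrite lexx; apply/bigmin_geP; split;
      first by case/andP: (dcb _ (MM0 _ jM)).
    by move=> v vZ; have [_ /andP[]] := ht _ _ vZ jM.
  - move=> f K2f v; rewrite inE => /andP[vY /ltW];
      rewrite (tval_det v _ K1V dP1 (kd _ (tauM _ vY)) K1f1 (sub2 _ K2f)) //.
  - by move=> f _ v w _; rewrite inE.
  - by move=> f _ v w _; rewrite inE.
have sgc2 := eftrim_sub sub2 sgc.
have ME : M = [set sg v | v in X]%SET by [].
have lp := @reach_contest X a M sg c d be Z t K2 K2V dP2 ME sgc2 sgbe ht IHX K2 _ _ _ _ (@subset_refl _ K2) ini.
have cM : #|M| = m by rewrite (card_in_imset (eftrim_inj sgc)).
apply: (reach_weaken lp).
  rewrite /contested imset0 finset.setD0 cM leq_mul2l; apply/orP; right.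
  by rewrite leq_sub2l // expn_gt0.
move=> K3 sub3 _ [T [W [om [e [h cW]]]]].
have sub31 : K3 `<=` K1 by move=> f /sub3 /sub2.
have TX := contest_TX h; have cT := card_contested ME sgc2 TX.
have XTv v : v \in T -> v \in X := fintype.subsetP TX v.
have Tin v : v \in T -> sg v \in M by move=> /XTv; exact: imset_f.
have cWT : #|(W :|: T)%SET| = m.
  rewrite cardsU (_ : #|(W :&: T)%SET| = 0%N) ?subn0; first by rewrite cW cT.
  by apply/eqP; rewrite cards_eq0; apply/eqP/setP => v; rewrite !inE;
    case: (boolP (v \in W)) => //= /(contest_WT h)/negPf.
have WTY : (W :|: T)%SET \subset Y.
  by rewrite finset.subUset {1}YE (contest_WY h) (fintype.subset_trans TX).
(* At the end [W] and [T] together are as many as the sold pieces, that is one fewer than the agents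
   of [Y]. *)
have /cards1P[x Lx] : #|losers X a T W| == 1%N.
  by rewrite /losers -YE cardsD (finset.setIidPr WTY) cY cWT subSnn.
have xL : x \in losers X a T W by rewrite Lx finset.in_set1.
have split3 v : v \in Y -> [\/ v \in T, v \notin T /\ v \in W |
  [/\ v \notin T, v \notin W & v = x]].
  move=> vY; case: (boolP (v \in T)) => vT; first by constructor 1.
  case: (boolP (v \in W)) => vW; first by constructor 2.
  constructor 3; split=> //; apply/eqP;
    rewrite -finset.in_set1 -Lx /losers -YE !inE (negPf vT) (negPf vW) //.
pose sg' v := if v \in T then sg v else if v \in W then om v else best v.
pose c' j := if j \in contested M sg T then e j else c j.
have cont_sg v : v \in T -> sg v \notin contested M sg T.
  by move=> vT; rewrite inE imset_f.
have cont_best v : best v \notin contested M sg T.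
  by apply/negP => /contestedM; have [] := bestP v; rewrite inE => /andP[/negPf ->].
have c'T v : v \in T -> c' (sg v) = c (sg v) by move=> vT;
  rewrite /c' (negPf (cont_sg _ vT)).
have c'W v : v \in W -> c' (om v) = e (om v) by move=> vW;
  rewrite /c' (eftrim_in (contest_efm h) vW).
have c'U v : c' (best v) = c (best v) by rewrite /c' (negPf (cont_best v)).
have c'le j : j \in M0 -> d j <= c' j <= c j.
  move=> jM; rewrite /c'; case: ifP => jT; last by case/andP: (dcb _ jM) => -> _;
    rewrite lexx.
  by have /andP[-> le] := contest_e h jT; apply: le_trans le (upper_le _ _ _ _).
have kc' j : j \in M0 -> known K3 (c' j).
  move=> jM; rewrite /c'; case: ifP => jT; first exact: eftrim_known (contest_efm h) _ jT.
  exact: known_sub sub31 (kc _ jM).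
have cover j : j \in M0 -> [\/ j \in contested M sg T, exists2 w, w \in T & j = sg w |
  j \in U].
  move=> jM; case: (boolP (j \in M)) => jM'; last by constructor 3; rewrite inE jM'.
  case: (boolP (j \in [set sg v | v in T]%SET)) => [/imsetP[w wT ->]|jT];
    first by constructor 2; exists w.
  by constructor 1; rewrite inE jT.
have Uc j : j \in U -> j \notin contested M sg T.
  by rewrite inE => /andP[jM _]; apply: contra jM; exact: contestedM.
exists sg', c'; split.
- split.
  + move=> v /split3[vT|[/negPf vT vW]|[/negPf vT /negPf vW _]]; rewrite /sg' vT ?vW.
    * exact/MM0/Tin.
    * by apply: MM0; apply: contestedM; exact: eftrim_in (contest_efm h) _ vW.
    * by apply: UM0; case: (bestP v).
  + have sgT v : v \in T -> sg' v = sg v by rewrite /sg' => ->.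
    have sgW v : v \notin T -> v \in W -> sg' v = om v by rewrite /sg' => /negPf -> ->.
    have sgx v : v \notin T -> v \notin W -> sg' v = best v
      by rewrite /sg' => /negPf -> /negPf ->.
    have TW v w : v \in T -> w \in W -> sg v = om w -> v = w.
      by move=> vT wW e1; have := cont_sg _ vT; rewrite e1 (eftrim_in (contest_efm h) wW).
    have Tb v w : v \in T -> sg v = best w -> v = w.
      by move=> vT e1; have [] := bestP w; rewrite -e1 inE Tin.
    have Wb v w : v \in W -> om v = best w -> v = w.
      by move=> vT e1; have := cont_best w; rewrite -e1 (eftrim_in (contest_efm h) vT).
    move=> v w /split3[vT|[vT vW]|[vT vW vx]] /split3[wT|[wT wW]|[wT wW wx]].
    * by rewrite !sgT //; apply: (eftrim_inj sgc); exact: XTv.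
    * by rewrite sgT // sgW //; exact: TW.
    * by rewrite sgT // sgx //; exact: Tb.
    * by rewrite sgW // sgT // => /esym /(TW _ _ wT vW).
    * by rewrite !sgW //; exact: eftrim_inj (contest_efm h) _ _ vW wW.
    * by rewrite sgW // sgx //; exact: Wb.
    * by rewrite sgx // sgT // => /esym /(Tb _ _ wT).
    * by rewrite sgx // sgW // => /esym /(Wb _ _ wW).
    * by rewrite vx wx.
  + exact: kc'.
  + move=> f K3f v j vY jM; have K1f := sub31 _ K3f; have K2f := sub3 _ K3f.
    have K3V : K3 `<=` profiles by move=> g /sub31 /K1V.
    have dP3 : known_pieces K3 by move=> i; exact: kpiece_sub sub31 (dP1 i).
    have [vT|[nT vW]|[nT nW vx]] := split3 _ vY.
    * rewrite /sg' vT c'T //; apply: le_trans (eftrim_ef sgc0 K1f (XTv _ vT) jM).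
      apply: (tval_le _ _ K3V dP3 K3f) => //;
        [exact: kc'|exact: known_sub sub31 (kc _ jM)|by case/andP: (c'le _ jM)].
    * rewrite /sg' (negPf nT) vW c'W //; have [jT|[w wT ->]|jU] := cover _ jM.
      - by rewrite /c' jT; exact: eftrim_ef (contest_efm h) _ K3f _ _ vW jT.
      - by rewrite c'T //; exact: contest_W h _ K3f _ _ vW wT.
      - rewrite /c' (negPf (Uc _ jU)); apply: le_trans (contest_be h K3f vW).
        by case: (bestP v) => _; apply.
    * rewrite /sg' (negPf nT) (negPf nW) c'U beE // vx;
        have [jT|[w wT ->]|jU] := cover _ jM.
      - rewrite /c' jT; have /andP[_ le] := contest_e h jT.
        have xZ : x \in Z := fintype.subsetP (contest_LZ h) _ xL.
        have [kt _ /(_ f K2f)[tb _]] := ht _ _ xZ (contestedM jT); apply: le_trans tb.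
        apply: (tval_le _ _ K3V dP3 K3f);
          [exact: eftrim_known (contest_efm h) _ jT|exact: known_sub sub3 kt|].
        apply: le_trans le _; exact: bigmin_le_cond.
      - by rewrite c'T //; exact: contest_L h _ K3f _ _ xL wT.
      - by rewrite /c' (negPf (Uc _ jU)); case: (bestP x) => _; apply.
- by move=> j jM; have /andP[-> h1] := c'le _ jM; case/andP: (dcb _ jM) => _;
    exact: le_trans.
- move=> j jM nov; have [jT|[w wT jw]|jU] := cover _ jM.
  + exfalso; have : [set om v | v in W]%SET == contested M sg T.
      rewrite eqEcard (card_in_imset (eftrim_inj (contest_efm h))) cW leqnn andbT.
      by apply/fintype.subsetP => _ /imsetP[v vW ->]; exact: eftrim_in (contest_efm h) _ vW.
    move=> /eqP eW; move: jT; rewrite -eW => /imsetP[v vW jv].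
    apply: (nov v); last by rewrite /sg' (negPf (contest_WT h vW)) vW.
    by rewrite YE; exact: (fintype.subsetP (contest_WY h)).
  + by case: (nov w); rewrite ?jw /sg' ?wT //; exact/(fintype.subsetP XY)/XTv.
  + rewrite /c' (negPf (Uc _ jU)); apply: full => // v vX vj.
    by move: jU; rewrite inE -vj imset_f.
Qed.

Lemma trimmable_all m : trimmable m.
Proof.
elim/ltn_ind: m => -[_|m IH]; first exact: trimmable0.
by apply: trimmableS => k km; apply: IH.
Qed.

End Trimming.

(** * Envy-free rounds *)

Section EnvyFree.
Local Open Scope classical_set_scope.
Local Open Scope ring_scope.

Variables (R : realType) (V : finType).
Local Notation prof := (V -> set R -> R).
Local Notation profiles := (profiles (R:=R) (V:=V)).
Implicit Types (K : set prof) (X : {set V}) (S : set R) (chi : R -> option V).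

(* The color [None] stands for the residue. *)
Record efcol K X S chi : Prop := EfCol {
  efcol_part : part K S chi;
  efcol_in : forall x v, chi x = Some v -> v \in X;
  efcol_ef : forall f, K f -> forall v u, v \in X ->
    f v (cls S chi (Some u)) <= f v (cls S chi (Some v)) }.

Lemma efcol_sub K K' X S chi : K' `<=` K -> efcol K X S chi -> efcol K' X S chi.
Proof.
by move=> sub [h1 h2 h3]; split=> //; [exact: part_sub sub h1|move=> f /sub; exact: h3].
Qed.

Lemma part_option K S chi f : part K S chi -> valuation f ->
  f S = f (cls S chi None) + \sum_v f (cls S chi (Some v)).
Proof.
move=> pc hf; have [_ ->] := part_total pc => //.
rewrite (bigD1 None) //=; congr (_ + _).
rewrite (reindex_omap Some id) //=; last by case.
by apply: eq_bigl => v; rewrite eqxx.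
Qed.

Definition core_cost := (#|V| * #|V|.+1 + trim_cost V V * 3 ^ #|V|)%N.

(** To [r] all pieces are equal before trimming, and she keeps a full one. So the residue is worth
    to her the sum of the differences between her piece and those of the others, hence at most [n]
    times the largest difference, attained at the agent [u] whose piece she values least. *)
Lemma reach_core K X r S : K `<=` profiles -> r \in X -> kpiece K S ->
  reach (fun K' => exists chi, [/\ efcol K' X S chi,
    forall f, K' f -> f r (cls S chi None) <= (1 - #|V|%:R^-1) * f r S &
    (1 < #|X|)%N -> exists2 u, u != r & forall f, K' f ->
      f r (cls S chi None) <= #|V|%:R * (f r (cls S chi (Some r)) - f r (cls S chi (Some u)))])
    core_cost K.
Proof.
move=> KV rX dS.
have sz : size (enum X) = #|X| by rewrite cardE.
have X0 : (0 < #|X|)%N by apply/card_gt0P; exists r.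
have Xn : (#|X| <= #|V|)%N by exact: max_card.
have ne : enum X != [::] by rewrite -size_eq0 sz -lt0n.
have le1 : (size (enum X) * #|V|.+1 <= #|V| * #|V|.+1)%N by rewrite sz leq_mul2r Xn orbT.
apply: (reach_bind (reach_le le1 (reach_equal r KV dS ne (enum_uniq _)))).
move=> K1 sub1 _ [io [ioX pio ioE]].
have K1V : K1 `<=` profiles by move=> f /sub1 /KV.
pose P (j : V) := cls S io j.
have dP : known_pieces P K1 by exact: pio.
have ioX' x : io x \in X by have := ioX x; rewrite mem_enum.
pose Y := (X :\ r)%SET.
have cY : #|X| = #|Y|.+1 by rewrite (cardsD1 r) rX.
have YX v : v \in Y -> v \in X by rewrite inE => /andP[].
(* The initial floor cuts every piece off at [0], where it is worth nothing to anybody. *)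
have ef0 : eftrim P K1 Y X id (fun=> 0).
  split=> //; first by move=> j _; exact: known0.
  by move=> f K1f v j vY jX; rewrite /tval !(pre0 (K1V _ K1f v) (dP _)).
apply: (reach_weaken (@trimmable_all _ _ _ P #|Y|
  K1 Y X (fun=> 1) id (fun=> 0) erefl K1V dP _ ef0)).
- by move=> j _; split; [exact: known1|exact: ler01].
- by rewrite leq_mul2l leq_exp2l // -ltnS -cY (leq_trans Xn) ?orbT.
move=> K2 sub2 [f0 K2f0] [sg [c [sgc cle full]]].
have K2V : K2 `<=` profiles by move=> f /sub2 /K1V.
have dP2 : known_pieces P K2 by move=> j; exact: kpiece_sub sub2 (dP j).
(* There is one piece more than there are agents other than [r]: an unsold piece, hence an untrimmed
   one, is left for [r]. *)
have [j0 j0X j0Y] : exists2 j0, j0 \in X & forall v, v \in Y -> sg v <> j0.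
  have /fintype.subsetPn[j jM jW] : ~~ (X \subset [set sg v | v in Y]%SET).
    apply/negP => /subset_leq_card; rewrite leqNgt => /negP; apply.
    by rewrite cY ltnS leq_imset_card.
  by exists j => // v vW e1; case/negP: jW; apply/imsetP; exists v.
have cj0 := full _ j0X j0Y.
pose sr v := if v == r then j0 else sg v.
have srY v : v \in X -> v != r -> v \in Y /\ sr v = sg v.
  by move=> vX vr; rewrite !inE vr vX /sr (negPf vr).
have srr : sr r = j0 by rewrite /sr eqxx.
have srX v : v \in X -> sr v \in X.
  by move=> vX; case: (eqVneq v r) => [->|vr]; [rewrite srr|have [vY ->] := srY _ vX vr;
    exact: eftrim_in sgc _ vY].
have srI : {in X &, injective sr}.
  move=> v w vX wX; case: (eqVneq v r) => [->|vr]; case: (eqVneq w r) => [->|wr] //.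
  - by have [wY ->] := srY _ wX wr; rewrite srr => /esym /(j0Y _ wY).
  - by have [vY ->] := srY _ vX vr; rewrite srr => /(j0Y _ vY).
  - by have [vY ->] := srY _ vX vr; have [wY ->] := srY _ wX wr;
      exact: eftrim_inj sgc _ _ vY wY.
have srS j : j \in X -> exists2 v, v \in X & sr v = j.
  have : [set sr v | v in X]%SET == X.
    rewrite eqEcard (card_in_imset srI) leqnn andbT.
    by apply/fintype.subsetP => _ /imsetP[v vX ->]; exact: srX.
  by move=> /eqP {1}<- /imsetP[v vX ->]; exists v.
pose own j := [pick v in X | sr v == j].
have ownE v : v \in X -> own (sr v) = Some v.
  move=> vX; rewrite /own; case: pickP => [w /andP[wX /eqP /srI e1]|/(_ v)];
    last by rewrite vX eqxx.
  by rewrite e1.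
have ownX j v : own j = Some v -> v \in X /\ sr v = j.
  by rewrite /own; case: pickP => // w /andP[wX /eqP e1] [<-].
(* Each point is marked with its piece and the side of the cut on which it lies; [hh] then renames
   the kept parts after their owners and throws all trimmings into the residue. *)
pose psi x := (io x, x <= c (io x)).
pose hh (jb : V * bool) := if jb.2 then own jb.1 else None.
have ppsi : part K2 S psi.
  move=> [j b]; have [jX|jX] := boolP (j \in X); last first.
    suff -> : cls S psi (j, b) = set0 by exact: kpiece0.
    by apply: setI0_intro => x _ [ij _]; case/negP: jX; rewrite -ij.
  have kcj := eftrim_known sgc jX.
  case: b.
    suff -> : cls S psi (j, true) = pre (P j) (c j) by exact: kpiece_pre.
    apply/seteqP; split=> x; first by move=> [Sx [ij h]]; split; [split|rewrite /= -ij].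
    by move=> [[Sx /= ij] /= xc]; split=> //; rewrite /psi /= ij xc.
  suff -> : cls S psi (j, false) = post (P j) (c j) by exact: kpiece_post.
  apply/seteqP; split=> x; first by move=> [Sx [ij h]]; split;
    [split|rewrite /= ltNge -ij h].
  by move=> [[Sx /= ij] /= xc]; split=> //; rewrite /psi /= ij leNgt xc.
pose chi := hh \o psi.
have [pchi _] := part_comp hh ppsi.
have clsE v : v \in X -> cls S chi (Some v) = pre (P (sr v)) (c (sr v)).
  move=> vX; apply/seteqP; split=> x.
    move=> [Sx /=]; rewrite /chi /hh /psi /=; case: ifP => // xc /ownX[_ e1].
    by rewrite e1; split=> //; split.
  move=> [[Sx /= ij] /= xc]; split=> //=; rewrite /chi /hh /psi /= ij xc; exact: ownE.
have cls0 v : v \notin X -> cls S chi (Some v) = set0.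
  move=> vX; apply: setI0_intro => x _ /=; rewrite /chi /hh /psi /=.
  by case: ifP => // _ /ownX[vX' _]; rewrite vX' in vX.
have dch v : kpiece K2 (cls S chi (Some v)) by exact: pchi.
have rE f : K2 f -> f r (cls S chi (Some r)) = f r S / #|X|%:R.
  move=> K2f; rewrite clsE // srr cj0 (pre1 (dP2 j0)) -sz; apply: ioE; first exact: sub2.
  by rewrite mem_enum.
have rle f u : K2 f -> f r (cls S chi (Some u)) <= f r S / #|X|%:R.
  move=> K2f; have hf := K2V _ K2f r; case: (boolP (u \in X)) => uX; last first.
    by rewrite cls0 // val0 // divr_ge0 // (kval_ge0 hf (kpiece_sub sub1 dS)).
  have suX := srX _ uX; rewrite -sz -(ioE _ (sub2 _ K2f) (sr u)) ?mem_enum // clsE //.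
  have [/andP[c0 _] _] := eftrim_known sgc suX; have /andP[_ c1] := cle _ suX.
  rewrite -[X in _ <= f r X](pre1 (dP2 (sr u))).
  exact: (pre_le hf (dP2 _)).
have totE f : K2 f -> f r S = f r (cls S chi None) + \sum_(v in X) f r (cls S chi (Some v)).
  move=> K2f; have hf := K2V _ K2f r; rewrite (part_option pchi hf); congr (_ + _).
  rewrite [RHS]big_mkcond /=; apply: eq_bigr => v _; case: ifP => // /negbT vX.
  by rewrite cls0 // val0.
have m0 : 0 < #|X|%:R :> R by rewrite ltr0n.
have n0 : 0 < #|V|%:R :> R by rewrite ltr0n (leq_trans X0).
have mn : #|X|%:R <= #|V|%:R :> R by rewrite ler_nat.
have Sge f : K2 f -> 0 <= f r S.
  by move=> K2f; exact: (kval_ge0 (K2V _ K2f r) dS).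
exists chi; split.
- split=> //.
  + by move=> x v; rewrite /chi /hh /psi /=; case: ifP => // _ /ownX[].
  + move=> f K2f v u vX; have hf := K2V _ K2f v.
    case: (boolP (u \in X)) => uX; last by rewrite cls0 // val0 //;
      exact: (kval_ge0 hf (dch v)).
    case: (eqVneq v r) => [->|vr]; first by rewrite rE //; exact: rle.
    have [vY e1] := srY _ vX vr; rewrite !clsE // e1.
    exact: eftrim_ef sgc _ K2f _ _ vY (srX _ uX).
- move=> f K2f; have hf := K2V _ K2f r.
  have := totE _ K2f; rewrite (bigD1 r) //= rE //.
  have : 0 <= \sum_(i in X | i != r) f r (cls S chi (Some i)).
    by apply: sumr_ge0 => v _; exact: (kval_ge0 hf (dch v)).
  have : f r S / #|V|%:R <= f r S / #|X|%:R by rewrite ler_wpM2l ?Sge // lef_pV2 ?posrE.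
  by lra.
- move=> X2.
  have [u1 u1Y] : exists u1, u1 \in Y by apply/card_gt0P; rewrite -ltnS -cY.
  pose u := [arg min_(u < u1 in Y) f0 r (cls S chi (Some u))]%O.
  have [uY umin] : u \in Y /\ forall f v, K2 f -> v \in Y ->
    f r (cls S chi (Some u)) <= f r (cls S chi (Some v)).
    rewrite /u; case: arg_minP => // i iY imin; split=> // f v K2f vY.
    by rewrite (kpiece_det r K2V (dch i) K2f K2f0) (kpiece_det r K2V (dch v) K2f K2f0);
      exact: imin.
  exists u; first by move: uY; rewrite !inE => /andP[].
  move=> f K2f; have hf := K2V _ K2f r.
  have sm : \sum_(v in Y) (f r S / #|X|%:R - f r (cls S chi (Some v))) <=
            #|Y|%:R * (f r S / #|X|%:R - f r (cls S chi (Some u))).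
    set z := _ - f r (cls S chi (Some u)).
    have -> : #|Y|%:R * z = \sum_(v in Y) z by rewrite sumr_const mulr_natl.
    apply: ler_sum => v vY; rewrite /z.
    by have := umin _ _ K2f vY; lra.
  have ru := rle f u K2f; rewrite -rE // in ru sm *.
  have e : f r (cls S chi None) = \sum_(v in Y) (f r (cls S chi (Some r)) - f r (cls S chi (Some v))).
    have := totE _ K2f; rewrite (bigD1 r) //= => e1.
    have -> : f r (cls S chi None) = f r S - f r (cls S chi (Some r)) - \sum_(i in X |
      i != r) f r (cls S chi (Some i)) by lra.
    have -> : f r S = #|X|%:R * f r (cls S chi (Some r)) by rewrite rE //; field;
      rewrite lt0r_neq0.
    rewrite big_split /= sumr_const sumrN cY -natr1 mulrDl mul1r addrK mulr_natl;
      congr (_ - _).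
    by apply: eq_bigl => i; rewrite !inE andbC.
  rewrite e; apply: le_trans sm _; rewrite ler_wpM2r ?subr_ge0 // ler_nat.
  by apply: leq_trans Xn; rewrite cY.
Qed.


Definition overlay chi1 chi2 : R -> option V :=
  fun x => if chi1 x is Some v then Some v else chi2 x.

Lemma overlay_some S chi1 chi2 v : cls S (overlay chi1 chi2) (Some v) =
  cls S chi1 (Some v) `|` cls (cls S chi1 None) chi2 (Some v).
Proof.
apply/seteqP; split=> x.
  by move=> [Sx /=]; rewrite /overlay; case E: (chi1 x) => [w|] h; [left; split=> //=;
    rewrite E|right].
by case=> [[Sx /= h]|[[Sx /= h] /= h']]; split=> //=; rewrite /overlay h.
Qed.

Lemma overlay_none S chi1 chi2 :
  cls S (overlay chi1 chi2) None = cls (cls S chi1 None) chi2 None.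
Proof.
apply/seteqP; split=> x.
  by move=> [Sx /=]; rewrite /overlay; case E: (chi1 x) => [w|] h.
by case=> [[Sx /= h] /= h']; split=> //=; rewrite /overlay h.
Qed.

Lemma overlay_part K S chi1 chi2 : part K S chi1 -> part K (cls S chi1 None) chi2 ->
  part K S (overlay chi1 chi2) /\ forall f, valuation f -> forall v,
    f (cls S (overlay chi1 chi2) (Some v)) =
    f (cls S chi1 (Some v)) + f (cls (cls S chi1 None) chi2 (Some v)).
Proof.
move=> p1 p2.
have d v : cls S chi1 (Some v) `&` cls (cls S chi1 None) chi2 (Some v) = set0.
  by apply: setI0_intro => x [_ /= e1] [[_ /=]]; rewrite e1.
split=> [[v|]|f hf v]; rewrite ?overlay_none ?overlay_some //; first exact: kpieceU.
exact: (kvalU hf (p1 _) (p2 _)).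
Qed.

Lemma efcol_overlay K X S chi1 chi2 : K `<=` profiles -> efcol K X S chi1 ->
  efcol K X (cls S chi1 None) chi2 -> efcol K X S (overlay chi1 chi2).
Proof.
move=> KV [p1 i1 e1] [p2 i2 e2]; have [p3 v3] := overlay_part p1 p2; split=> //.
  by move=> x v; rewrite /overlay; case E: (chi1 x) => [w|] => [[<-]|];
    [exact: i1 E|exact: i2].
by move=> f Kf v u vX; rewrite !(v3 _ (KV _ Kf v)) lerD ?e1 ?e2.
Qed.

Lemma efcol_none K X S : K `<=` profiles -> kpiece K S ->
  efcol K X S (fun=> None) /\ cls S (fun=> None : option V) None = S.
Proof.
move=> KV dS; have e : cls S (fun=> None : option V) None = S by apply/setIidPl.
have e' v : cls S (fun=> None) (Some v) = set0 by apply: setI0_intro.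
split=> //; split=> // [[v|]|f Kf v u vX]; rewrite ?e ?e' //; exact: kpiece0.
Qed.

(** A round is sure to shrink the residue only in the eyes of its cutter, and enlarges it for
    nobody. This is why the agents must take turns, and why the exponent counts the occurrences of
    [y]. *)
Lemma reach_shrink_seq K X S (rs : seq V) : K `<=` profiles -> kpiece K S ->
  {subset rs <= X} ->
  reach (fun K' => exists chi, efcol K' X S chi /\ forall f, K' f -> forall y, y \in X ->
    f y (cls S chi None) <= (1 - #|V|%:R^-1) ^+ count_mem y rs * f y S)
    (size rs * core_cost) K.
Proof.
move=> KV dS; elim: rs => [|r rs IH] sub.
  apply: reach_done => _; have [ef e] := efcol_none X KV dS.
  by exists (fun=> None); split=> // f Kf y _; rewrite e expr0 mul1r.
rewrite /= mulSn addnC; apply: (reach_bind (IH _)); first by move=> x xr; apply: sub;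
  rewrite inE xr orbT.
move=> K1 sub1 _ [chi1 [ef1 h1]]; have K1V : K1 `<=` profiles by move=> f /sub1 /KV.
have rX : r \in X by apply: sub; rewrite mem_head.
apply: (reach_weaken (reach_core K1V rX (efcol_part ef1 None))) => // K2 sub2 _ [chi2 [ef2 h2 _]].
have K2V : K2 `<=` profiles by move=> f /sub2 /K1V.
exists (overlay chi1 chi2); split; first exact: efcol_overlay (efcol_sub sub2 ef1) ef2.
move=> f K2f y yX; rewrite overlay_none.
have hf := K2V _ K2f y; have h1' := h1 f (sub2 _ K2f) y yX.
have n1 : 0 <= 1 - #|V|%:R^-1 :> R.
  rewrite subr_ge0 invf_le1 ?ler1n ?ltr0n; by apply/card_gt0P; exists r.
have [<-|ry] := eqVneq r y.
  by apply: le_trans (h2 _ K2f) _; rewrite /= add1n exprS -mulrA ler_wpM2l //;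
    apply: h1 => //; exact: sub2.
rewrite /= add0n; apply: le_trans h1'.
rewrite (part_option (efcol_part ef2) hf) lerDl; apply: sumr_ge0 => v _.
exact: (kval_ge0 hf (efcol_part ef2 _)).
Qed.

Lemma bernoulli (x : R) n : 0 <= x -> 1 + n%:R * x <= (1 + x) ^+ n.
Proof.
move=> x0; elim: n => [|n IH]; first by rewrite mul0r addr0 expr0.
rewrite exprS -natr1; apply: le_trans (ler_wpM2l _ IH); last by lra.
have : 0 <= n%:R * x * x by rewrite !mulr_ge0.
lra.
Qed.

(** With [y = 1 / n], the product of [(1 - y) ^ n] and [(1 + y) ^ n] is at most [1], while the
    second factor is at least [2] by Bernoulli's inequality. *)
Lemma expr_half n : (0 < n)%N -> (1 - n%:R^-1) ^+ n <= 2^-1 :> R.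
Proof.
move=> n0; set y : R := n%:R^-1.
have n0' : 0 < n%:R :> R by rewrite ltr0n.
have y0 : 0 < y by rewrite invr_gt0.
have y1 : y <= 1 by rewrite invf_le1 // ler1n.
have b := @bernoulli y n (ltW y0); rewrite mulfV ?lt0r_neq0 // in b.
have h : (1 - y) ^+ n * (1 + y) ^+ n <= 1.
  rewrite -exprMn; apply: exprn_ile1; last by nra.
  by apply: mulr_ge0; lra.
have p : 0 <= (1 - y) ^+ n by apply: exprn_ge0; lra.
nra.
Qed.

(** By [expr_half], [#|V|] rounds with the same cutter halve the residue for her; this is done [l]
    times for each agent. *)
Definition shrink_cost l := (#|V| * l * #|V| * core_cost)%N.

Lemma reach_shrink K X S l : K `<=` profiles -> kpiece K S ->
  reach (fun K' => exists chi, efcol K' X S chi /\ forall f, K' f -> forall y, y \in X ->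
    2 ^+ l * f y (cls S chi None) <= f y S) (shrink_cost l) K.
Proof.
move=> KV dS; pose rs := flatten (nseq (#|V| * l) (enum X)).
have cnt (p : pred V) k s : count p (flatten (nseq k s)) = (k * count p s)%N.
  by elim: k => //= k IH; rewrite count_cat IH mulSn.
have sub : {subset rs <= X}.
  by move=> x /flattenP[s /nseqP[-> _]]; rewrite mem_enum.
apply: (reach_weaken (reach_shrink_seq KV dS sub)).
  rewrite /shrink_cost leq_mul2r -count_predT cnt count_predT -cardE leq_mul2l max_card;
    lia.
move=> K' sub' _ [chi [ef h]]; exists chi; split=> // f K'f y yX.
have hf := KV _ (sub' _ K'f) y.
have n0 : (0 < #|V|)%N by apply/card_gt0P; exists y.
have cE : count_mem y rs = (#|V| * l)%N.
  by rewrite cnt count_uniq_mem ?enum_uniq // mem_enum yX muln1.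
have S0 : 0 <= f y S by exact: (kval_ge0 hf dS).
have := h _ K'f _ yX; rewrite cE exprM => h1.
have p2 : 0 < 2 ^+ l :> R by rewrite exprn_gt0.
have n1 : 0 <= 1 - #|V|%:R^-1 :> R.
  by rewrite subr_ge0 invf_le1 ?ler1n ?ltr0n.
have h2 : ((1 - #|V|%:R^-1) ^+ #|V|) ^+ l <= 2^-1 ^+ l :> R.
  by apply: lerXn2r; rewrite ?nnegrE ?exprn_ge0 ?invr_ge0 //; exact: expr_half.
rewrite exprVn in h2.
have h3 : f y (cls S chi None) <= (2 ^+ l)^-1 * f y S by apply: le_trans h1 _;
  rewrite ler_wpM2r.
by move: h3; rewrite -ler_pdivlMl ?invr_gt0 // invrK.
Qed.

End EnvyFree.

(** * Local proportionality *)

Section LocalProportionality.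
Local Open Scope classical_set_scope.
Local Open Scope ring_scope.

Variables (R : realType) (V : finType) (e : rel V).
Hypothesis esym : symmetric e.
Hypothesis eirr : irreflexive e.
Hypothesis econ : forall u v, connect e u v.
Hypothesis V0 : (0 < #|V|)%N.
Local Notation prof := (V -> set R -> R).
Local Notation profiles := (profiles (R:=R) (V:=V)).
Local Notation n := #|V|.
Local Notation nb := (neighbors e).
Implicit Types (K : set prof) (D X : {set V}) (S : set R) (chi : R -> option V) (f : prof).

(** The margin in the constraint of [y], multiplied by her degree. A slack that covers the residue
    protects her even if all of it goes to one neighbor. *)
Definition slack f S chi y : R :=
  \sum_(z in nb y) (f y (cls S chi (Some y)) - f y (cls S chi (Some z))).

Lemma slack_overlay K S chi1 chi2 f y : part K S chi1 -> part K (cls S chi1 None) chi2 ->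
  valuation (f y) ->
  slack f S (overlay chi1 chi2) y = slack f S chi1 y + slack f (cls S chi1 None) chi2 y.
Proof.
move=> p1 p2 hf; have [_ h] := overlay_part p1 p2.
by rewrite /slack -big_split /=; apply: eq_bigr => z _; rewrite !h //; lra.
Qed.

Lemma slack_ge0 K X S chi f y : efcol K X S chi -> K f -> y \in X -> 0 <= slack f S chi y.
Proof. by move=> ef Kf yX; apply: sumr_ge0 => z _; rewrite subr_ge0;
  exact: efcol_ef ef _ Kf _ _ yX. Qed.

Lemma efcol_out K X S chi v : efcol K X S chi -> v \notin X -> cls S chi (Some v) = set0.
Proof. by move=> ef vX; apply: setI0_intro => x _ /= /(efcol_in ef);
  rewrite (negPf vX). Qed.

Lemma slack_term K X S chi f y z : efcol K X S chi -> K f -> y \in X -> z \in nb y ->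
  f y (cls S chi (Some y)) - f y (cls S chi (Some z)) <= slack f S chi y.
Proof.
move=> ef Kf yX zy; rewrite /slack (bigD1 z) //= lerDl; apply: sumr_ge0 => w _.
by rewrite subr_ge0; exact: efcol_ef ef _ Kf _ _ yX.
Qed.

(** The agent need not belong to [X]: whoever is left out of the rounds loses at most the value of
    all that is handed out, each share counting once. *)
Lemma slack_outside K X S chi f y : K `<=` profiles -> efcol K X S chi -> K f ->
  - (f y S - f y (cls S chi None)) <= slack f S chi y.
Proof.
move=> KV ef Kf; have hf := KV _ Kf y.
rewrite (part_option (efcol_part ef) hf) addrC addKr -sumrN /slack.
have g0 v : 0 <= f y (cls S chi (Some v)) by exact: (kval_ge0 hf (efcol_part ef _)).
rewrite [leRHS]big_mkcond /=; apply: ler_sum => z _; case: ifP => _; have := g0 y;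
  have := g0 z; lra.
Qed.

(** By [small_class], one among so many classes is worth to everyone at most [n / reserve], that is
    [1 / (8 * n)], of the residue. This is the size of each of the three errors that [reach_stage]
    absorbs. *)
Definition reserve := (8 * n ^ 2)%N.

Lemma reserve_gt0 : (0 < reserve)%N.
Proof. by rewrite /reserve muln_gt0 expn_gt0 V0. Qed.

(** With the value of [S] normalized for each agent, the classes have a total weight of at most [n]
    over all agents, so some class has a weight of at most [n / #|T|], and each agent contributes no
    more than that. *)
Lemma small_class K S (T : finType) (ka : R -> T) f : K `<=` profiles -> K f ->
  part K S ka ->
  (0 < #|T|)%N -> exists i, forall y : V, #|T|%:R * f y (cls S ka i) <= n%:R * f y S.
Proof.
move=> KV Kf pk T0; pose w i := \sum_y f y (cls S ka i) / f y S.
have T0' : 0 < #|T|%:R :> R by rewrite ltr0n.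
have [dS tot] := part_total pk.
have S0 y : 0 <= f y S by exact: (kval_ge0 (KV _ Kf y) dS).
have c0 y i : 0 <= f y (cls S ka i) by exact: (kval_ge0 (KV _ Kf y) (pk i)).
have sw : \sum_i w i <= n%:R.
  rewrite exchange_big /= -sum1_card natr_sum; apply: ler_sum => y _.
  rewrite -mulr_suml -tot; last exact: KV.
  by have [->|h] := eqVneq (f y S) 0; [rewrite mul0r ler01|rewrite divff].
have [i wi] : exists i, #|T|%:R * w i <= n%:R.
  apply: contrapT => no; have [i0 _] := card_gt0P T0.
  suff : n%:R < \sum_i w i by rewrite ltNge sw.
  have <- : \sum_(i : T) (n%:R / #|T|%:R : R) = n%:R.
    by rewrite sumr_const -mulr_natl; field; rewrite lt0r_neq0.
  apply: ltr_sum; first by apply/hasP; exists i0; rewrite // mem_index_enum.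
  move=> i _; rewrite ltr_pdivrMr // mulrC ltNge; apply/negP => h; apply: no; by exists i.
exists i => y; have [Sy|Sy] := eqVneq (f y S) 0.
  have : f y (cls S ka i) <= f y S.
    by rewrite tot; [|exact: KV]; rewrite (bigD1 i) //= lerDl sumr_ge0.
  rewrite Sy mulr0 => h; have -> : f y (cls S ka i) = 0 by apply/eqP; rewrite eq_le h c0.
  by rewrite mulr0.
have Sy' : 0 < f y S by rewrite lt_neqAle eq_sym Sy S0.
rewrite -ler_pdivrMr // -mulrA; apply: le_trans wi; apply: ler_wpM2l; first exact: ltW.
by rewrite /w (bigD1 y) //= lerDl; apply: sumr_ge0 => z _; apply: divr_ge0.
Qed.

(* The constraints of the agents of [D] survive whatever happens to the residue; those
   of the other agents hold, except that [u] may have a small deficit. *)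
Record staged K chi D u (th : R) : Prop := Staged {
  staged_part : part K (cake R) chi;
  staged_D : forall f, K f -> forall y, y \in D ->
    f y (cls (cake R) chi None) <= slack f (cake R) chi y;
  staged_out : forall f, K f -> forall y, y \notin D -> y != u ->
    0 <= slack f (cake R) chi y;
  staged_u : forall f, K f -> u \notin D ->
    - (th * f u (cls (cake R) chi None)) <= slack f (cake R) chi u }.

Definition stage_cost := (reserve * n.+1 + shrink_cost V (n + 3))%N.

(* A part of the residue, one of [reserve] parts that [u] finds equal, is put aside: the
   deficit of [u] remains small compared to what is left, while the part is negligible
   for everyone else. *)
Lemma reach_stage K chi D u y0 z (th : R) : K `<=` profiles -> part K (cake R) chi ->
  0 <= th -> th * (8 * n%:R) <= 1 -> z \in D -> e y0 z -> y0 \notin D ->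
  (forall f, K f -> forall y, y \in D ->
    f y (cls (cake R) chi None) <= slack f (cake R) chi y) ->
  (forall f, K f -> forall y, y \notin D -> y != u -> y != y0 ->
    0 <= slack f (cake R) chi y) ->
  (forall f, K f -> forall y, y \in [:: u; y0] -> y \notin D ->
    - (th * f y (cls (cake R) chi None)) <= slack f (cake R) chi y) ->
  reach (fun K' => exists chi',
    staged K' chi' (y0 |: D)%SET u (reserve%:R * th)) stage_cost K.
Proof.
move=> KV pc th0 th1 zD y0z y0D hD hout hu.
set S := cls (cake R) chi None in hD hu; have dS : kpiece K S := pc None.
pose T := 'I_reserve; have cT : #|T| = reserve by rewrite card_ord.
have T0 : (0 < #|T|)%N by rewrite cT reserve_gt0.
have sz : size (enum T) = reserve by rewrite -cardE cT.
have ne : enum T != [::] by rewrite -size_eq0 sz -lt0n reserve_gt0.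
have n0 : 0 < n%:R :> R by rewrite ltr0n.
have resE : reserve%:R = 8 * n%:R ^+ 2 :> R by rewrite /reserve natrM natrX.
have res0 : 0 < reserve%:R :> R by rewrite ltr0n reserve_gt0.
have := reach_equal u KV dS ne (enum_uniq _); rewrite sz => req.
apply: (reach_bind req) => K1 sub1 [f1 K1f1] [ka [_ pka kaE]].
have K1V : K1 `<=` profiles by move=> f /sub1 /KV.
have [i0 hi0] := small_class K1V K1f1 pka T0; rewrite cT in hi0.
have [pb vb] := part_comp (fun i => i == i0) pka.
set hb := _ \o ka in pb vb.
set Z := cls S ka i0 in hi0; pose S1 := cls S hb false.
have ZE : Z = cls S hb true.
  by apply/seteqP; split=> x [Sx /= h]; split=> //=; [rewrite /hb /= h eqxx|apply/eqP].
have dZ1 : kpiece K1 Z := pka i0.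
apply: (reach_weaken (reach_shrink (~: D)%SET (n + 3) K1V (pb false))) => // K2 sub2 _ [chi1 [ef1 h1]].
have K2V : K2 `<=` profiles by move=> f /sub2 /K1V.
have sub20 : K2 `<=` K by move=> f /sub2 /sub1.
rewrite -/S1 in ef1 h1.
(* The class put aside rejoins what the rounds on [S1] leave over; together they are the new
   residue. *)
pose chi2 x := if ka x == i0 then None else chi1 x.
have c2S v : cls S chi2 (Some v) = cls S1 chi1 (Some v).
  apply/seteqP; split=> x.
    by move=> [Sx /=]; rewrite /chi2; case: ifP => // h1' h2; split=> //; split.
  by move=> [[Sx /= h1'] /= h2]; split=> //=; rewrite /chi2; move: h1';
    rewrite /hb /= => ->.
have c2N : cls S chi2 None = Z `|` cls S1 chi1 None.
  apply/seteqP; split=> x.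
    move=> [Sx /=]; rewrite /chi2; case: eqP => [h _|/eqP h h2]; [by left|right].
    by split=> //; split=> //=; rewrite /hb /= (negPf h).
  case=> [[Sx /= h]|[[Sx /= h] /= h2]]; split=> //=; rewrite /chi2; first by rewrite h eqxx.
  by move: h; rewrite /hb /= => ->.
have dj : Z `&` cls S1 chi1 None = set0.
  by apply: setI0_intro => x [_ /= h] [[_ /=]]; rewrite /hb /= h eqxx.
have dZ : kpiece K2 Z := kpiece_sub sub2 dZ1.
have p2 : part K2 S chi2.
  by case=> [v|]; rewrite ?c2S ?c2N; [exact: efcol_part ef1 _|apply: kpieceU => //;
    exact: efcol_part ef1 _].
have pc2 := part_sub sub20 pc.
have [po _] := overlay_part pc2 p2.
have slE f y : K2 f -> slack f (cake R) (overlay chi chi2) y = slack f (cake R) chi y + slack f S1 chi1 y.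
  move=> K2f; rewrite (slack_overlay pc2 p2 (K2V _ K2f y)); congr (_ + _).
  by apply: eq_bigr => w _; rewrite !c2S.
have facts f y : K2 f -> [/\ f y S = f y Z + f y S1,
    f y (cls (cake R) (overlay chi chi2) None) = f y Z + f y (cls S1 chi1 None),
    reserve%:R * f y Z <= n%:R * f y S & 0 <= f y Z].
  move=> K2f; have hf := K2V _ K2f y; split.
  - by have [_ ->] := part_total pb => //; rewrite big_bool /= -ZE.
  - by rewrite overlay_none c2N (kvalU hf dZ (efcol_part ef1 None) dj).
  - rewrite (kpiece_det y K1V dZ1 (sub2 _ K2f) K1f1).
    by rewrite (kpiece_det y K1V (kpiece_sub sub1 dS) (sub2 _ K2f) K1f1).
  - exact: (kval_ge0 hf dZ).
exists (overlay chi chi2); split=> //.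
- move=> f K2f y; rewrite finset.in_setU1 => yD'; rewrite slE //.
  have [fS -> fZ Z0] := facts f y K2f.
  have hf := K2V _ K2f y.
  have nu0 : 0 <= f y (cls S1 chi1 None) by exact: (kval_ge0 hf (efcol_part ef1 None)).
  have so := slack_outside y K2V ef1 K2f.
  (* An agent of [D] begins with a slack that covers [S] and loses at most what is handed out, so
     her slack still covers the rest. *)
  case: (boolP (y \in D)) => yD; first by have := hD f (sub20 _ K2f) y yD; lra.
  have yy0 : y = y0 by move: yD'; rewrite (negPf yD) orbF => /eqP.
  have yX : y \in (~: D)%SET by rewrite inE.
  (* The neighbor [z] receives nothing in this stage, so the slack of [y0] grows by at least her own
     share, which without envy is at least [1 / n] of what is handed out. Against this stand the
     part [Z], the rest of [S1] and the old deficit, each at most [1 / (8 * n)] of [S]. *)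
  have znb : z \in nb y by rewrite inE yy0.
  have st := slack_term ef1 K2f yX znb.
  rewrite (efcol_out (v := z) ef1) ?inE ?zD // val0 // subr0 in st.
  have hth := hu f (sub20 _ K2f) y; rewrite !inE yy0 eqxx orbT -yy0 yD in hth.
  have {}hth := hth isT isT.
  have nug : f y S1 - f y (cls S1 chi1 None) <= n%:R * f y (cls S1 chi1 (Some y)).
    rewrite (part_option (efcol_part ef1) hf) addrC addKr.
    rewrite mulr_natl -sumr_const; apply: ler_sum => v _; exact: efcol_ef ef1 _ K2f _ _ yX.
  have h1y := h1 _ K2f _ yX.
  have S10 : 0 <= f y S1 by exact: (kval_ge0 hf (pb false)).
  have p2n : 8 * n%:R <= 2 ^+ (n + 3) :> R.
    rewrite -natrX -natrM ler_nat expnD mulnC leq_mul2r; apply/orP; right.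
    exact/ltnW/ltn_expl.
  have nu1 : 8 * n%:R * f y (cls S1 chi1 None) <= f y S1 by apply: le_trans h1y;
    rewrite ler_wpM2r.
  have ze1 : 8 * n%:R * f y Z <= f y S.
    rewrite -(ler_pM2l n0); apply: le_trans fZ; rewrite resE; rewrite le_eqVlt; apply/orP;
      left; apply/eqP; ring.
  have th2 : th * f y S * (8 * n%:R) <= f y S.
    by rewrite mulrAC ler_piMl //; lra.
  rewrite -(@ler_pM2l _ (8 * n%:R)); last by lra.
  have n1 : 1 <= n%:R :> R by rewrite ler1n.
  have q1 : f y Z <= n%:R * f y Z by rewrite ler_peMl.
  have q2 : f y (cls S1 chi1 None) <= n%:R * f y (cls S1 chi1 None) by rewrite ler_peMl.
  have q3 : 8 * n%:R * f y (cls S1 chi1 (Some y)) <= 8 * n%:R * slack f S1 chi1 y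
    by rewrite ler_pM2l //; lra.
  have q4 : 8 * n%:R * - (th * f y S) <= 8 * n%:R * slack f (cake R) chi y
    by rewrite ler_pM2l //; lra.
  lra.
- move=> f K2f y; rewrite finset.in_setU1 negb_or => /andP[yy0 yD] yu; rewrite slE //.
  apply: addr_ge0; first exact: hout (sub20 _ K2f) _ yD yu yy0.
  by apply: slack_ge0 ef1 K2f _; rewrite inE.
- move=> f K2f; rewrite finset.in_setU1 negb_or => /andP[yy0 yD]; rewrite slE //.
  have [fS -> fZ Z0] := facts f u K2f.
  have hf := K2V _ K2f u.
  have nu0 : 0 <= f u (cls S1 chi1 None) by exact: (kval_ge0 hf (efcol_part ef1 None)).
  have hth := hu f (sub20 _ K2f) u (mem_head _ _) yD.
  have s0 : 0 <= slack f S1 chi1 u by apply: slack_ge0 ef1 K2f _; rewrite inE.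
  (* The part [Z] stays in the residue and is worth to [u] exactly [1 / reserve] of the old one; her
     deficit relative to the residue is thus multiplied by at most [reserve]. *)
  have ZS : reserve%:R * f u Z = f u S.
    rewrite (kaE _ (sub2 _ K2f)) ?mem_enum //; field; exact: lt0r_neq0.
  have : th * f u S <= reserve%:R * th * (f u Z + f u (cls S1 chi1 None)).
    rewrite -ZS [reserve%:R * th]mulrC -mulrA ler_wpM2l //; apply: ler_wpM2l;
      [exact: ltW|lra].
  lra.
Qed.


Definition solved K := exists A : V -> set R, complete_allocation A /\
  forall f, K f -> locally_proportional e f A.

Lemma slack_lp f (A : V -> set R) y :
  0 <= \sum_(z in nb y) (f y (A y) - f y (A z)) -> 0 <= f y (A y) ->
  f y (A y) >= 1 / #|nb y|%:R * \sum_(u in nb y) f y (A u).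
Proof.
rewrite big_split /= sumrN sumr_const subr_ge0 => h A0.
have [e0|e0] := eqVneq #|nb y| 0%N; first by rewrite e0 invr0 mulr0 mul0r.
have d0 : 0 < #|nb y|%:R :> R by rewrite ltr0n lt0n.
by rewrite div1r mulrC ler_pdivrMr // mulr_natr.
Qed.

(** The whole residue goes to one agent [v0]. For anyone else it enters at most one term of the sum,
    which her slack covers; [v0] is not her own neighbor and only gains. *)
Lemma solved_all K chi u (th : R) : K `<=` profiles -> staged K chi [set: V]%SET u th ->
  solved K.
Proof.
move=> KV [pc hD _ _]; have [v0 _] := card_gt0P V0.
have [pA vA] := part_comp (odflt v0) pc; set chi' := _ \o chi in pA vA.
have vE (g : set R -> R) : valuation g -> forall v, g (cls (cake R) chi' v) =
    g (cls (cake R) chi (Some v)) + (if v == v0 then g (cls (cake R) chi None) else 0).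
  move=> hf v; rewrite vA // big_mkcond (bigD1 None) //= addrC; congr (_ + _);
    last by rewrite eq_sym.
  rewrite (bigD1 (Some v)) //= eqxx big1 ?addr0 // => -[w|] //= wv.
  by case: eqP => // wv'; rewrite wv' eqxx in wv.
exists (cls (cake R) chi'); split.
  split.
  - by move=> v; exact: kpiece_piece (pA v).
  - by move=> v w _ _ [x [[_ /= <-] [_ /= <-]]].
  - apply/seteqP; split=> x; first by case=> v _ [].
    by move=> Cx; exists (chi' x).
move=> f Kf y; have hf := KV _ Kf y; apply: slack_lp; last exact: (kval_ge0 hf (pA y)).
have hy := hD _ Kf y (finset.in_setT y).
have N0 : 0 <= f y (cls (cake R) chi None) by exact: (kval_ge0 hf (pc None)).
have [yv|yv] := eqVneq y v0.
  apply: (le_trans N0); apply: (le_trans hy); apply: ler_sum => z znb.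
  have zv : z != v0 by apply/eqP => zv; move: znb; rewrite inE zv yv eirr.
  have yv1 : (y == v0) = true by apply/eqP.
  by rewrite !vE // yv1 (negPf zv); lra.
have -> : \sum_(z in nb y) (f y (cls (cake R) chi' y) - f y (cls (cake R) chi' z)) =
    slack f (cake R) chi y - \sum_(z in nb y) (if z == v0 then f y (cls (cake R) chi None) else 0).
  by rewrite /slack -sumrB; apply: eq_bigr => z _; rewrite !vE // (negPf yv); lra.
suff : \sum_(z in nb y) (if z == v0 then f y (cls (cake R) chi None) else 0) <=
  f y (cls (cake R) chi None) by lra.
rewrite -big_mkcondr /=; have [vn|vn] := boolP (v0 \in nb y).
  rewrite (big_pred1 v0) // => z /=; by case: eqP => [->|]; rewrite ?vn ?andbF.
by rewrite big1 // => z /andP[znb /eqP zv]; rewrite zv (negPf vn) in znb.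
Qed.

Lemma border D : D != finset.set0 -> D != [set: V]%SET ->
  exists y z, [/\ y \notin D, z \in D & e y z].
Proof.
move=> /set0Pn[z0 z0D] DT; have [y0 y0D] : exists y0, y0 \notin D.
  apply: contrapT => no; case/eqP: DT; apply/setP => y; rewrite finset.in_setT;
    apply: contrapT => yD.
  by apply: no; exists y; apply/negP.
apply: contrapT => no; have cl : closed e (mem D).
  move=> x y exy; apply/idP/idP => h; apply: contrapT => /negP h'; apply: no.
    by exists y, x; rewrite esym.
  by exists x, y.
by have := closed_connect cl (econ z0 y0); rewrite z0D (negPf y0D).
Qed.

(** Each stage adds one agent to [D] and multiplies the relative deficit of [u] by [reserve]. The
    bound on [th] keeps it below [1 / (8 * n)] through all [m] stages. *)
Lemma reach_finish m K chi D u (th : R) : K `<=` profiles -> #|~: D|%SET = m ->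
  D != finset.set0 ->
  0 <= th -> reserve%:R ^+ m * th * (8 * n%:R) <= 1 -> staged K chi D u th ->
  reach solved (m * stage_cost) K.
Proof.
elim: m K chi D th => [|m IH] K chi D th KV cD D0 th0 th1 st.
  have DT : D = [set: V]%SET.
    by move/eqP: cD; rewrite cards_eq0 => /eqP cD;
      rewrite -(finset.setCK D) cD finset.setC0.
  by apply: reach_done => _; rewrite DT in st; exact: solved_all st.
have DT : D != [set: V]%SET.
  by apply/eqP => DT; move: cD; rewrite DT finset.setCT cards0.
have [y0 [z [y0D zD y0z]]] := border D0 DT.
have res1 : 1 <= reserve%:R :> R by rewrite ler1n reserve_gt0.
have n0 : 0 < n%:R :> R by rewrite ltr0n.
have th2 : th * (8 * n%:R) <= 1.
  apply: le_trans th1; rewrite -mulrA ler_peMl ?exprn_ege1 //.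
  by rewrite mulr_ge0 // mulr_ge0 // ltW.
rewrite mulSn; apply: (reach_bind (reach_stage (u :=
  u) KV (staged_part st) th0 th2 zD y0z y0D (staged_D st) _ _)).
- by move=> f Kf y yD yu _; exact: (staged_out st).
- move=> f Kf y; rewrite !inE => yuy yD; have [yu|yu] := eqVneq y u.
    by rewrite yu in yD *; exact: (staged_u st).
  apply: le_trans (staged_out st Kf yD yu); rewrite oppr_le0 mulr_ge0 //.
  exact: (kval_ge0 (KV _ Kf y) (staged_part st None)).
move=> K' sub _ [chi' st']; apply: (IH K' chi' _ _ _ _ _ _ _ st').
- by move=> f /sub /KV.
- have := cardsD1 y0 (~: D)%SET; rewrite cD inE y0D => -[->]; congr #|pred_of_set _|.
  by apply/setP => y; rewrite !inE negb_or.
- by apply/set0Pn; exists y0; rewrite finset.setU11.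
- by rewrite mulr_ge0.
- apply: le_trans th1; rewrite le_eqVlt; apply/orP; left; apply/eqP; rewrite exprSr; ring.
Qed.

(** This many halvings shrink the residue by [reserve ^ n.+1], because
    [8 * n ^ 2 <= 2 ^ (2 * n + 3)]. One factor [reserve] pays for the [n] neighbors of a swapped
    agent and for the [8 * n] of [reach_stage], the others for the stages. *)
Definition dist_len := ((2 * n + 3) * n.+1)%N.

Lemma reserve_len : (reserve ^ n.+1 <= 2 ^ dist_len)%N.
Proof.
rewrite /dist_len expnM leq_exp2r // /reserve addnC expnD leq_mul2l /= mulnC expnM leq_exp2r //.
exact/ltnW/ltn_expl.
Qed.

Definition swap (u w : V) (o : option V) : option V :=
  if o == Some u then Some w else if o == Some w then Some u else o.

Lemma swapK u w : involutive (swap u w).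
Proof.
move=> o; rewrite /swap; have [->|ou] := eqVneq o (Some u).
  by rewrite eqxx; case: eqP => // ->.
have [->|ow] := eqVneq o (Some w); first by rewrite eqxx.
by rewrite (negPf ou) (negPf ow).
Qed.

Lemma cls_swap S chi u w o : cls S (swap u w \o chi) o = cls S chi (swap u w o).
Proof.
apply/seteqP; split=> x [Sx /= h]; split=> //=; first by rewrite -h swapK.
by rewrite h swapK.
Qed.

Lemma reach_dist K chi v p : K `<=` profiles -> efcol K [set: V]%SET (cake R) chi ->
  path e v p -> v != last v p ->
  (forall f, K f -> f v (cls (cake R) chi None) <=
    f v (cls (cake R) chi (Some v)) - f v (cls (cake R) chi (Some (last v p)))) ->
  reach solved (size p * shrink_cost V dist_len + n.+1 * stage_cost) K.
Proof.
have [m] := ubnP (size p); elim: m K chi v p => // m IH K chi v [|w p];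
  first by move=> _ _ _ _; rewrite /= eqxx.
rewrite ltnS => szp KV ef /= /andP[evw pth]; set u := last w p => vu dom.
have n0 : 0 < n%:R :> R by rewrite ltr0n.
have vw : v != w by apply/eqP => vw; move: evw; rewrite vw eirr.
have wnb : w \in nb v by rewrite inE.
have cD : (#|~: [set v]%SET| <= n)%N by exact: max_card.
have D0 : [set v]%SET != finset.set0 by apply/set0Pn; exists v; rewrite finset.set11.
have efT f y z : K f -> f y (cls (cake R) chi (Some z)) <= f y (cls (cake R) chi (Some y)).
  by move=> Kf; apply: efcol_ef ef _ Kf _ _ _; rewrite finset.in_setT.
have N0 f y : K f -> 0 <= f y (cls (cake R) chi None).
  by move=> Kf; exact: (kval_ge0 (KV _ Kf y) (efcol_part ef None)).
have [wu|wu] := eqVneq w u.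
  (* Nobody has a deficit here: [v] belongs to [D], so she can stand in for the exceptional agent,
     with ratio [0]. *)
  have st : staged K chi [set v]%SET v 0.
    split; [exact: efcol_part ef| | |by move=> f _; rewrite finset.set11].
      move=> f Kf y; rewrite finset.in_set1 => /eqP ->; apply: le_trans (dom _ Kf) _.
      by rewrite -wu; exact: slack_term ef Kf (finset.in_setT _) wnb.
    by move=> f Kf y _ _; exact: slack_ge0 ef Kf (finset.in_setT _).
  apply: reach_le (reach_finish KV erefl D0 (lexx 0) _ st);
    last by rewrite mulr0 mul0r ler01.
  by apply: leq_trans (leq_addl _ _); rewrite leq_mul2r (leq_trans cD) ?leqnSn ?orbT.
apply: reach_nonempty => -[f0 Kf0].
pose et : R := (2 ^+ dist_len)^-1.
have et0 : 0 < et by rewrite invr_gt0 exprn_gt0.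
have det f y o : K f -> f y (cls (cake R) chi o) = f0 y (cls (cake R) chi o).
  by move=> Kf; exact: (kpiece_det y KV (efcol_part ef o) Kf Kf0).
(* If [a] prefers her piece to that of [b] by [et] times the residue, then [dist_len] halvings turn
   this into domination along a path that is shorter by one edge. *)
have rec a b q : path e a q -> last a q = b -> a != b -> size q = size p ->
    et * f0 a (cls (cake R) chi None) <=
      f0 a (cls (cake R) chi (Some a)) - f0 a (cls (cake R) chi (Some b)) ->
    reach solved ((size p).+1 * shrink_cost V dist_len + n.+1 * stage_cost) K.
  move=> pq lq ab sq adv; rewrite mulSn -addnA.
  apply: (reach_bind (reach_shrink [set: V]%SET dist_len KV (efcol_part ef None))).
  move=> K1 sub1 _ [chi1 [ef1 h1]]; rewrite -sq.
  have K1V : K1 `<=` profiles by move=> f /sub1 /KV.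
  have ef' := efcol_sub sub1 ef.
  have [_ vo] := overlay_part (efcol_part ef') (efcol_part ef1).
  apply: (IH K1 (overlay chi chi1) a q) => //;
    [by rewrite sq|exact: efcol_overlay|by rewrite lq|].
  move=> f K1f; have hf := K1V _ K1f a; have Kf := sub1 _ K1f.
  rewrite lq !vo // overlay_none.
  have := efcol_ef ef1 K1f b (finset.in_setT a).
  have := h1 _ K1f a (finset.in_setT a).
  rewrite -ler_pdivlMl ?exprn_gt0 // -/et; move: adv; rewrite !(det f) //; lra.
have [h1|h1] := leP (et * f0 w (cls (cake R) chi None))
      (f0 w (cls (cake R) chi (Some w)) - f0 w (cls (cake R) chi (Some u))).
  exact: (rec w u p).
have [h2|h2] := leP (et * f0 u (cls (cake R) chi None))
      (f0 u (cls (cake R) chi (Some u)) - f0 u (cls (cake R) chi (Some w))).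
  (* The way back from [u] to [w] has as many edges as [p]. *)
  apply: (rec u w (rev (belast w p))) => //; last by rewrite size_rev size_belast.
  - by rewrite rev_path (eq_path (e' := e)) // => x y; rewrite esym.
  - by rewrite /u; case: (p) wu => [|x s _]; rewrite /u /= ?eqxx // rev_cons last_rcons.
  - by rewrite eq_sym.
pose chi' := swap w u \o chi; have [pchi' _] := part_comp (swap w u) (efcol_part ef).
rewrite -/chi' in pchi'.
have cE o : cls (cake R) chi' o = cls (cake R) chi (swap w u o) by exact: cls_swap.
have sN : swap w u None = None by [].
have sw : swap w u (Some w) = Some u by rewrite /swap eqxx.
have su : swap w u (Some u) = Some w.
  by rewrite /swap eqxx; case: eqP => // -[uw]; rewrite uw eqxx in wu.
have so y : y != w -> y != u -> swap w u (Some y) = Some y.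
  move=> yw yu; rewrite /swap; case: eqP => [[yw']|_]; first by rewrite yw' eqxx in yw.
  by case: eqP => // -[yu']; rewrite yu' eqxx in yu.
have ss y : exists y', swap w u (Some y) = Some y'.
  by rewrite /swap; case: eqP => _; [exists u|case: eqP => _; [exists w|exists y]].
have efs f y z : K f -> f y (cls (cake R) chi (swap w u (Some z))) <=
  f y (cls (cake R) chi (Some y)).
  by move=> Kf; have [z' ->] := ss z; exact: efT.
(* The swap costs [w] and [u] less than [et] times the residue in the comparison with each neighbor,
   and there are at most [n] neighbors. *)
pose th : R := n%:R * et.
have th0 : 0 <= th by rewrite mulr_ge0 ?ltW.
have slb f y : K f -> - (et * f y (cls (cake R) chi None)) <=
      f y (cls (cake R) chi' (Some y)) - f y (cls (cake R) chi (Some y)) ->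
    - (th * f y (cls (cake R) chi' None)) <= slack f (cake R) chi' y.
  move=> Kf h; rewrite cE sN /th -mulrA.
  apply: (@le_trans _ _ (\sum_(z in nb y) - (et * f y (cls (cake R) chi None)))).
    rewrite sumrN lerN2 sumr_const -[X in X <= _]mulr_natl ler_wpM2r //;
      last by rewrite ler_nat max_card.
    by apply: mulr_ge0; [exact: ltW|exact: N0].
  apply: ler_sum => z _; apply: le_trans h _; rewrite lerB // !cE; exact: efs.
have resE : reserve%:R = 8 * n%:R ^+ 2 :> R by rewrite /reserve natrM natrX.
have res1 : 1 <= reserve%:R :> R by rewrite ler1n reserve_gt0.
have thE k : (k <= n)%N -> reserve%:R ^+ k * th * (8 * n%:R) <= 1.
  move=> kle; have -> : reserve%:R ^+ k * th * (8 * n%:R) = reserve%:R ^+ k.+1 * et :> R.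
    by rewrite exprSr /th resE; ring.
  rewrite ler_pdivrMr ?exprn_gt0 // mul1r.
  apply: (@le_trans _ _ (reserve%:R ^+ n.+1)); first by rewrite ler_weXn2l.
  by rewrite -!natrX ler_nat reserve_len.
have ewv : e w v by rewrite esym.
have wD : w \notin [set v]%SET by rewrite finset.in_set1 eq_sym.
have th1 := thE 0%N (leq0n _); rewrite expr0 mul1r in th1.
apply: (@reach_le _ _ _ (stage_cost + n * stage_cost)%N).
  by rewrite -mulSn; exact: leq_addl.
(* Since [w] is adjacent to [v], the first stage takes her into [D] and repairs her deficit at once;
   only that of [u] is carried on. *)
apply: (reach_bind (reach_stage (u := u) KV pchi' th0 th1 (finset.set11 v) ewv wD _ _ _)).
- move=> f Kf y; rewrite finset.in_set1 => /eqP ->; rewrite cE sN;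
    apply: le_trans (dom _ Kf) _.
  rewrite /slack (bigD1 w) //= !cE sw so // lerDl; apply: sumr_ge0 => z _.
  by rewrite subr_ge0 cE; exact: efs.
- move=> f Kf y _ yu yw; apply: sumr_ge0 => z _.
  by rewrite subr_ge0 !cE (so y) //; exact: efs.
- move=> f Kf y; rewrite !inE => /orP[/eqP ->|/eqP ->] _; apply: slb => //;
    rewrite cE ?su ?sw !(det f) //.
  + by move: h2; lra.
  + by move: h1; lra.
move=> K1 sub1 _ [chi2 st2].
have K1V : K1 `<=` profiles by move=> f /sub1 /KV.
have cD2 : (#|~: (w |: [set v])%SET|%SET < n)%N.
  rewrite -[X in (_ < X)%N](cardsC (w |: [set v])%SET) -[X in (X < _)%N]add0n ltn_add2r.
  by rewrite card_gt0; apply/set0Pn; exists w; rewrite finset.setU11.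
have D2 : (w |: [set v])%SET != finset.set0 by apply/set0Pn; exists w;
  rewrite finset.setU11.
apply: reach_le (reach_finish K1V erefl D2 _ _ st2).
- by rewrite leq_mul2r ltnW ?orbT.
- by rewrite mulr_ge0.
- apply: le_trans (thE _ cD2); rewrite le_eqVlt; apply/orP; left; apply/eqP;
    rewrite exprSr; ring.
Qed.

(** A round that yields some domination up to the factor [n], a shrinking phase that removes this
    factor, at most [n] phases that reduce the distance, and the final stages. *)
Definition total_cost := (core_cost V + (shrink_cost V dist_len +
  (n * shrink_cost V dist_len + n.+1 * stage_cost)))%N.

Lemma reach_solved : (1 < n)%N -> reach solved total_cost profiles.
Proof.
move=> n2; have [r _] := card_gt0P V0; have rT := finset.in_setT r.
have cT : (1 < #|[set: V]%SET|)%N by rewrite cardsT.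
apply: (reach_bind (reach_core (@subset_refl _ _) rT (kpiece_cake (@subset_refl _ _)))).
move=> K1 K1V _ [chi1 [ef1 _ /(_ cT)[u ur dom]]].
apply: (reach_bind (reach_shrink [set: V]%SET dist_len K1V (efcol_part ef1 None))).
move=> K2 sub2 _ [chi2 [ef2 h2]].
have K2V : K2 `<=` profiles by move=> f /sub2 /K1V.
have ef1' := efcol_sub sub2 ef1.
have [_ vo] := overlay_part (efcol_part ef1') (efcol_part ef2).
have /connectP[p0 pth0 lp0] := econ r u.
case/shortenP: pth0 lp0 => p pth up _ lp.
have szp : (size p <= n)%N.
  by apply: ltnW; have := card_uniqP up; rewrite /= => <-; exact: max_card.
apply: (@reach_le _ _ _ (size p * shrink_cost V dist_len + n.+1 * stage_cost)%N).
  by rewrite leq_add2r leq_mul2r szp orbT.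
apply: (reach_dist K2V (efcol_overlay K2V ef1' ef2) pth); first by rewrite -lp eq_sym.
move=> f K2f; have hf := K2V _ K2f r; rewrite -lp overlay_none !vo //.
have a2 := efcol_ef ef2 K2f u rT; have d1 := dom _ (sub2 _ K2f); have s2 := h2 _ K2f r rT.
have N0 : 0 <= f r (cls (cls (cake R) chi1 None) chi2 None)
  by exact: (kval_ge0 hf (efcol_part ef2 None)).
have n0 : 0 < n%:R :> R by rewrite ltr0n.
(* The number of halvings is far more than the removal of the factor [n] requires; reusing
   [dist_len] avoids a second parameter. *)
have nl : n%:R <= 2 ^+ dist_len :> R.
  rewrite -natrX ler_nat; apply: leq_trans (ltnW (ltn_expl n (ltnSn 1))) _;
    rewrite leq_exp2l //.
  by rewrite /dist_len; nia.
have nN : n%:R * f r (cls (cls (cake R) chi1 None) chi2 None) <=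
    n%:R * (f r (cls (cake R) chi1 (Some r)) - f r (cls (cake R) chi1 (Some u))).
  by apply: le_trans d1; apply: le_trans s2; rewrite ler_wpM2r.
by rewrite ler_pM2l // in nN; lra.
Qed.

End LocalProportionality.

(** * * The number of queries *)

Section Cost.
Local Open Scope nat_scope.

(** It suffices that [n <= k * 2 ^ (n %/ k)], raised to the power [k]. *)
Lemma pow_le_expn k n : 0 < k -> n ^ k <= k ^ k * 2 ^ n.
Proof.
move=> k0; have le : n <= k * 2 ^ (n %/ k).
  apply: (@leq_trans (k * (n %/ k).+1)); last by rewrite leq_mul2l ltn_expl ?orbT.
  by rewrite mulnC ltnW // ltn_ceil.
apply: (@leq_trans ((k * 2 ^ (n %/ k)) ^ k)); first by rewrite leq_exp2r.
by rewrite expnMn leq_mul2l -expnM leq_exp2l // leq_trunc_div orbT.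
Qed.


(** The exponent [8] comes from [n] shrinking phases of order [n ^ 2] halvings, each made of [n ^ 2]
    rounds whose cost is of order [n ^ 3 * 3 ^ n]. The constant is [4 + 40 + 40 + 64]: the first
    round, one shrinking phase, [n] further ones, and the stages. *)
Lemma total_cost_poly (V : finType) : 0 < #|V| ->
  total_cost V <= 148 * (#|V| ^ 8 * 3 ^ #|V|).
Proof.
rewrite /total_cost /stage_cost /shrink_cost /core_cost /trim_cost /dist_len /reserve.
move: #|V| => n n0; set t := 3 ^ n; have t0 : 0 < t by rewrite expn_gt0.
have mono i j : i <= j -> n ^ i <= n ^ j * t.
  move=> ij; apply: (@leq_trans (n ^ j)); first by rewrite leq_pexp2l.
  by rewrite leq_pmulr.
have monot i j : i <= j -> n ^ i * t <= n ^ j * t.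
  by move=> ij; rewrite leq_mul2r leq_pexp2l ?orbT.
set core := n * n.+1 + n * n * n.+1 * t.
have coreE : core <= 4 * (n ^ 3 * t).
  have -> : core = n ^ 2 + n ^ 1 + (n ^ 3 * t + n ^ 2 * t) by rewrite /core; ring.
  have := mono 2 3 isT; have := mono 1 3 isT; have := monot 2 3 isT; lia.
have shr l k c : l <= c * n ^ k -> n * l * n * core <= 4 * c * (n ^ (k + 5) * t).
  move=> lk; apply: (@leq_trans (n * (c * n ^ k) * n * (4 * (n ^ 3 * t)))).
    by apply: leq_mul => //; rewrite leq_mul2r leq_mul2l lk !orbT.
  by rewrite expnD; apply/eq_leq; ring.
have s1 : n * ((2 * n + 3) * n.+1) * n * core <= 4 * 10 * (n ^ 7 * t).
  by apply: (shr _ 2); nia.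
have s2 : n * (n + 3) * n * core <= 4 * 4 * (n ^ 6 * t) by apply: (shr _ 1); nia.
move: s1 s2; set a := n * _ * n * core; set b := n * _ * n * core => s1 s2.
have st : 8 * n ^ 2 * n.+1 + b <= 32 * (n ^ 6 * t).
  have -> : 8 * n ^ 2 * n.+1 = 8 * n ^ 3 + 8 * n ^ 2 by ring.
  have := mono 3 6 isT; have := mono 2 6 isT; lia.
have na : n * a <= 40 * (n ^ 8 * t).
  apply: (@leq_trans (n * (4 * 10 * (n ^ 7 * t)))); first by rewrite leq_mul2l s1 orbT.
  by apply/eq_leq; ring.
have nst : n.+1 * (8 * n ^ 2 * n.+1 + b) <= 64 * (n ^ 8 * t).
  apply: (@leq_trans (n.+1 * (32 * (n ^ 6 * t)))); first by rewrite leq_mul2l st orbT.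
  have -> : n.+1 * (32 * (n ^ 6 * t)) = 32 * (n ^ 7 * t) + 32 * (n ^ 6 * t) by ring.
  have := monot 7 8 isT; have := monot 6 8 isT; lia.
have := monot 3 8 isT; have := monot 7 8 isT; lia.
Qed.

(** A constant times [2 ^ n] absorbs the polynomial factor, and [2 * 3 <= 14]. *)
Lemma total_cost_le : exists C, forall V : finType, 0 < #|V| ->
  total_cost V <= C * 14 ^ #|V|.
Proof.
have [C hC] : exists C, forall n, n ^ 8 <= C * 2 ^ n by exists (8 ^ 8) => n;
  exact: pow_le_expn.
exists (148 * C) => V V0; apply: leq_trans (total_cost_poly V0) _.
rewrite -mulnA leq_mul2l; apply/orP; right.
apply: (@leq_trans (C * 2 ^ #|V| * 3 ^ #|V|)); first by rewrite leq_mul2r hC orbT.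
by rewrite -mulnA leq_mul2l -expnMn leq_exp2r ?orbT.
Qed.

End Cost.

Theorem theorem3 (R : realType) :
  exists (P : forall V : finType, rel V -> protocol R V) (C : nat),
    forall (V : finType) (e : rel V) (f : V -> set R -> R),
      2 <= #|V| -> connected_graph e -> (forall v, valuation (f v)) ->
      legal f (P V e) /\
      forall (q : nat) (A : V -> set R), run f (P V e) q A ->
        [/\ complete_allocation A,
            locally_proportional e f A
          & q <= C * 14 ^ #|V|].
Proof.
have [C hC] := total_cost_le.
(* Graphs are packed into one type so that a protocol can be chosen for each of them by [cid],
   before any valuation is given. *)
have h (Ve : {V : finType & rel V}) : exists P : protocol R (projT1 Ve),
    2 <= #|projT1 Ve| -> connected_graph (projT2 Ve) ->
    forall f : projT1 Ve -> set R -> R, (forall v, valuation (f v)) ->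
    legal f P /\ forall q A, run f P q A ->
      [/\ complete_allocation A,
        locally_proportional (projT2 Ve) f A & q <= C * 14 ^ #|projT1 Ve|].
  case: Ve => V e /=.
  have [[V2 [esym eirr econ]]|no] := pselect (2 <= #|V| /\ connected_graph e); last first.
    (* A default protocol for graphs that violate the hypotheses. *)
    by exists (Output (fun=> set0)) => V2 ce; case: no.
  have V0 : 0 < #|V| := ltnW V2.
  have [P hP] := reach_protocol (Post :=
    fun f A => complete_allocation A /\ locally_proportional e f A)
    (reach_solved R esym eirr econ V0 V2)
    (fun K _ _ '(ex_intro A (conj cA lA)) =>
       ex_intro _ A (fun f Kf => conj cA (lA f Kf))).
  exists P => _ _ f hf; have [leg hr] := hP f hf; split=> // q A /hr[[cA lA] qle].
  by split=> //; apply: leq_trans qle (hC _ V0).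
exists (fun V e => projT1 (cid (h (existT _ V e)))), C => V e f V2 ce hf.
exact: (projT2 (cid (h (existT _ V e))) V2 ce f hf).
Qed.
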